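(* Let $r\ge 0$ be an integer. The following spaces of differential forms on the tetrahedron $T^3$ have bases that are $S_4$-invariant up to sign if and only if the corresponding condition holds: \begin{itemize} \item $\mathcal P_r\Lambda^1(T^3)$: always; \item $\mathcal P_r^-\Lambda^1(T^3)$: if and only if $r\notin 3\mathbb N_0+2$; \item $\mathcal P_r\Lambda^2(T^3)$: always; \item $\mathcal P_r^-\Lambda^2(T^3)$: always; \item $\mathring{\mathcal P}_r\Lambda^1(T^3)$: always; \item $\mathring{\mathcal P}_r^-\Lambda^1(T^3)$: always; \item $\mathring{\mathcal P}_r\Lambda^2(T^3)$: if and only if $r\notin 3\mathbb N_0+3$; \item $\mathring{\mathcal P}_r^-\Lambda^2(T^3)$: always. \end{itemize}
   Context: $T^n\subset\mathbb R^{n+1}$ is the standard simplex $\{(\lambda_0,\dots,\lambda_n):\lambda_i\ge 0,\ \sum_i\lambda_i=1\}$. $\mathcal P_r\Lambda^k(\mathbb R^{n+1})$ denotes the $k$-forms on $\mathbb R^{n+1}$ with polynomial coefficients of degree at most $r$ (zero if $r<0$). With $X$ the position vector field on $\mathbb R^{n+1}$ and $i_X$ contraction with $X$, $\mathcal P_r^-\Lambda^k(\mathbb R^{n+1}):=i_X\bigl(\mathcal P_{r-1}\Lambda^{k+1}(\mathbb R^{n+1})\bigr)$. The spaces $\mathcal P_r\Lambda^k(T^n)$ and $\mathcal P_r^-\Lambda^k(T^n)$ are the images of these spaces under restriction (pullback) to $T^n$. $\mathring{\mathcal P}_r\Lambda^k(T^n)$, $\mathring{\mathcal P}_r^-\Lambda^k(T^n)$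 denote the subspaces of forms whose trace (pullback) vanishes on every $(n-1)$-dimensional face of $T^n$. The symmetric group $S_{n+1}$ (permutations of $\{0,\dots,n\}$) acts on these spaces as follows: for $\pi\in S_{n+1}$ let $S_\pi(\lambda_0,\dots,\lambda_n)=(\lambda_{\pi(0)},\dots,\lambda_{\pi(n)})$, and let $\pi$ act on forms by the pullback $S_\pi^*$. A basis $\xi_1,\dots,\xi_m$ of a representation $V$ of a group $G$ is $G$-invariant up to sign if for every $g\in G$ and every $i$ there is $i'$ with $g\xi_i=\pm\xi_{i'}$. $\mathbb N_0=\{0,1,2,\dots\}$ and $3\mathbb N_0+a=\{3m+a:m\in\mathbb N_0\}$. *)

(* Defs.v *)
(* the real numbers are an arbitrary [realType]
   (any two realTypes are isomorphic complete ordered fields). *)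
From HB Require Import structures.
From mathcomp Require Import all_boot all_order all_algebra all_fingroup.
From mathcomp Require Import reals.


Import Order.TTheory GRing.Theory Num.Theory.
Local Open Scope ring_scope.

Section Forms.
Variable R : realType.
(* Ambient space R^(n+1), coordinates lambda_0..lambda_n, indexed by 'I_n.+1. *)
Variable n : nat.

Definition pt := 'I_n.+1 -> R.

(* A k-form (on R^(n+1) or on T^n), seen as the map
   (x, v_1..v_k) |-> omega_x(v_1, ..., v_k). *)
Definition form (k : nat) := pt -> ('I_k -> pt) -> R.

(* f is a polynomial function of degree < d  (d = 0 : f = 0). *)
Definition poly_lt (d : nat) (f : pt -> R) : Prop :=
  exists c : {ffun 'I_n.+1 -> 'I_d} -> R,
    forall x, f x = \sum_(a : {ffun 'I_n.+1 -> 'I_d} | (\sum_i (a i : nat) < d)%N)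
                      c a * \prod_i x i ^+ a i.

(* d lambda_{f 0} /\ ... /\ d lambda_{f (k-1)} evaluated on v_0..v_{k-1}. *)
Definition dlam k (f : 'I_k -> 'I_n.+1) (vs : 'I_k -> pt) : R :=
  \det (\matrix_(a < k, b < k) vs b (f a)).

Definition inP_lt (d k : nat) (w : form k) : Prop :=
  exists p : {ffun 'I_k -> 'I_n.+1} -> pt -> R,
    (forall f, poly_lt d (p f)) /\
    forall x vs, w x vs = \sum_(f : {ffun 'I_k -> 'I_n.+1}) p f x * dlam k f vs.

Definition inP (r k : nat) (w : form k) : Prop := inP_lt r.+1 k w.

Definition consv k (x : pt) (vs : 'I_k -> pt) : 'I_k.+1 -> pt :=
  fun j => if unlift ord0 j is Some j' then vs j' else x.

Definition contrX k (eta : form k.+1) : form k :=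
  fun x vs => eta x (consv k x vs).

(* P_r^- Lambda^k (R^(n+1)) = i_X (P_{r-1} Lambda^{k+1}), P_{-1} = 0 *)
Definition inPminus (r k : nat) (w : form k) : Prop :=
  exists eta : form k.+1, inP_lt r k.+1 eta /\ forall x vs, w x vs = contrX k eta x vs.

Definition inT (x : pt) : bool := [forall i, 0 <= x i] && (\sum_i x i == 1).
Definition tangent (v : pt) : bool := \sum_i v i == 0.

Definition restr k (w : form k) : form k := fun x vs =>
  if inT x && [forall b, tangent (vs b)] then w x vs else 0.

Definition onT (S : forall k, form k -> Prop) k (xi : form k) : Prop :=
  exists w : form k, S k w /\ forall x vs, xi x vs = restr k w x vs.

Definition PT (r k : nat) : form k -> Prop := onT (inP r) k.
Definition PminusT (r k : nat) : form k -> Prop := onT (inPminus r) k.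

Definition trace_free k (xi : form k) : Prop :=
  forall (j : 'I_n.+1) x vs, inT x -> x j = 0 ->
    (forall b, tangent (vs b) /\ vs b j = 0) -> xi x vs = 0.

Definition ringed k (V : form k -> Prop) (xi : form k) : Prop :=
  V xi /\ trace_free k xi.

Definition act (s : {perm 'I_n.+1}) k (xi : form k) : form k :=
  fun x vs => xi (fun i => x (s i)) (fun b i => vs b (s i)).

Definition is_basis k (V : form k -> Prop) m (xi : 'I_m -> form k) : Prop :=
  [/\ (forall i, V (xi i)),
      (forall c : 'I_m -> R,
          (forall x vs, \sum_i c i * xi i x vs = 0) -> forall i, c i = 0) &
      (forall w, V w -> exists c : 'I_m -> R,
          forall x vs, w x vs = \sum_i c i * xi i x vs)].

Definition inv_up_to_sign k m (xi : 'I_m -> form k) : Prop :=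
  forall (s : {perm 'I_n.+1}) (i : 'I_m), exists (i' : 'I_m) (e : bool),
    forall x vs, act s k (xi i) x vs = (-1) ^+ e * xi i' x vs.

Definition has_inv_basis k (V : form k -> Prop) : Prop :=
  exists m (xi : 'I_m -> form k), is_basis k V m xi /\ inv_up_to_sign k m xi.

End Forms.

Arguments PT {R n} r k _.
Arguments PminusT {R n} r k _.
Arguments ringed {R n k} V _.
Arguments has_inv_basis {R n k} V.

(* Main.v *)
From mathcomp Require Import all_boot all_order all_algebra all_fingroup reals.
From mathcomp Require Import mpoly ring lra zify.
Require Import Defs.

(** Each of the eight spaces is identified, compatibly with the action up to
the sign character, with a space of 4-tuples of homogeneous polynomials that
is graded by monomials: a 1-form is sum_i p_i dlambda_i, a 2-form is
det [x, u(x), v, w], and after shifting the i-th coefficient by a monomial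
depending only on i, the conditions defining the space involve, for each
monomial m, only the vector in R^4 of coefficients at m, and depend only on
the support of m.  On full supports that vector ranges over the sum-zero
space, which has the signed basis of the three splittings of four indices
into two pairs.  Smaller supports contribute nothing, a line, or (for
P_r^- Lambda^1 and the trace-free P_r Lambda^2) the sum-zero plane of a face,
which has a signed basis permuted by the stabilizer of m unless the three
exponents are equal.  When such an m exists, a 3-cycle acts on the whole
space with trace -1, whereas an element of order 3 has nonnegative trace in a
signed permutation representation. *)

Set Implicit Arguments.
Unset Strict Implicit.
Unset Printing Implicit Defensive.

Import Order.TTheory GRing.Theory Num.Theory.
Local Open Scope ring_scope.

(** * Determinants of small size *)

(** On the simplex the coordinates sum to 1, so a polynomial of degree at most [r] can be replaced
    by one homogeneous of degree [r], and a homogeneous polynomial is determined by its values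
    there. Different monomials are then coupled only through the position field: by the relation
    [sum_i x_i p_i = 0] for [P_r^- Lambda^1], and by the freedom to add [x_i a] to the i-th
    coefficient for [P_r^- Lambda^2]. Shifting by [x_i], respectively by the product of the other
    three variables, moves the coupled coefficients to one monomial.

    Blocks thus have degree [r], [r + 1] or [r + 2]. The obstructing monomial is [(q, q, q, 0)] with
    [q > 0], so the block degree must be a positive multiple of 3. It is [r + 1] for
    [P_r^- Lambda^1], whence [r = 3m + 2], and [r] for the trace-free [P_r Lambda^2], whence
    [r = 3m + 3], with [r = 0] harmless. *)

Section Det4.
Variable R : comRingType.

Definition det4 (x u v w : 'I_4 -> R) : R :=
  \det (\matrix_(i < 4, j < 4) nth x [:: x; u; v; w] i j).

Lemma det4_perm (s : 'S_4) x u v w :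
  det4 (x \o s) (u \o s) (v \o s) (w \o s) = (-1) ^+ s * det4 x u v w.
Proof.
rewrite /det4 -[LHS]det_tr -[X in _ * X]det_tr -det_perm -det_mulmx -row_permE.
congr (\det _); apply/matrixP => j i; rewrite !mxE.
by case: i => -[|[|[|[|//]]]].
Qed.

Definition o0 : 'I_4 := @Ordinal 4 0 isT.
Definition o1 : 'I_4 := @Ordinal 4 1 isT.
Definition o2 : 'I_4 := @Ordinal 4 2 isT.
Definition o3 : 'I_4 := @Ordinal 4 3 isT.

Lemma ord4_ind (P : 'I_4 -> Prop) : P o0 -> P o1 -> P o2 -> P o3 -> forall i, P i.
Proof.
move=> p0 p1 p2 p3 [[|[|[|[|//]]]] lt].
- by rewrite (_ : Ordinal lt = o0) //; apply: val_inj.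
- by rewrite (_ : Ordinal lt = o1) //; apply: val_inj.
- by rewrite (_ : Ordinal lt = o2) //; apply: val_inj.
- by rewrite (_ : Ordinal lt = o3) //; apply: val_inj.
Qed.

Lemma big4 (T : Type) (idx : T) (op : Monoid.law idx) (F : 'I_4 -> T) :
  \big[op/idx]_(i < 4) F i = op (F o0) (op (F o1) (op (F o2) (F o3))).
Proof.
rewrite !big_ord_recl big_ord0 Monoid.mulm1.
by congr (op (F _) (op (F _) (op (F _) (F _)))); apply: val_inj.
Qed.

Lemma det4E x u v w : det4 x u v w =
  let m i j k := u i * (v j * w k - v k * w j) - u j * (v i * w k - v k * w i)
                 + u k * (v i * w j - v j * w i) in
  x o0 * m o1 o2 o3 - x o1 * m o0 o2 o3 + x o2 * m o0 o1 o3 - x o3 * m o0 o1 o2.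
Proof.
(* Entries indexed by natural numbers let the nested lifts of the cofactor expansion compute, so
   that [ring] meets identical atoms. *)
have nat_of (f : 'I_4 -> R) : exists g : nat -> R, forall i, f i = g i.
  by exists (fun k => f (inord k)) => i; rewrite inord_val.
have [[x' ex] [u' eu] [v' ev] [w' ew]] := And4 (nat_of x) (nat_of u) (nat_of v) (nat_of w).
rewrite /det4.
do 3 rewrite !(expand_det_row _ ord0) !big_ord_recl !big_ord0 /cofactor.
rewrite !det_mx11 !mxE /= !(ex, eu, ev, ew) /= /bump /=; ring.
Qed.

Lemma det_mx33 (A : 'M[R]_3) : \det A =
  let i0 := ord0 in let i1 := lift ord0 ord0 in let i2 := ord_max in
  A i0 i0 * (A i1 i1 * A i2 i2 - A i1 i2 * A i2 i1)
  - A i0 i1 * (A i1 i0 * A i2 i2 - A i1 i2 * A i2 i0)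
  + A i0 i2 * (A i1 i0 * A i2 i1 - A i1 i1 * A i2 i0).
Proof.
have [B eB] : exists B : nat -> nat -> R, forall i j, A i j = B i j.
  by exists (fun i j => A (inord i) (inord j)) => i j; rewrite !inord_val.
do 2 rewrite !(expand_det_row _ ord0) !big_ord_recl !big_ord0 /cofactor.
rewrite !det_mx11 !mxE /= !eB /= /bump /=; ring.
Qed.

Lemma det_mx22 (A : 'M[R]_2) :
  \det A = A ord0 ord0 * A ord_max ord_max - A ord0 ord_max * A ord_max ord0.
Proof.
have [B eB] : exists B : nat -> nat -> R, forall i j, A i j = B i j.
  by exists (fun i j => A (inord i) (inord j)) => i j; rewrite !inord_val.
rewrite (expand_det_row _ ord0) !big_ord_recl !big_ord0 /cofactor.
rewrite !det_mx11 !mxE /= !eB /= /bump /=; ring.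
Qed.

End Det4.

(** * Coefficient spaces and their signed bases *)

Local Notation mon := 'X_{1..4}.
Local Notation "m # s" := [multinom (m : mon) (s i) | i < 4]
  (at level 40, left associativity, format "m # s").

Section CoefficientModel.
Variable R : realFieldType.

Definition blk := {ffun 'I_4 -> R^o}.
Definition vec := {ffun 'I_4 -> {mpoly R[4]}}.

(** Pullback by [s] turns [d lambda_i] into [d lambda_(s i)], so entry [j] comes from the entry at
    the preimage of [j]. *)
Definition vact (s : 'S_4) (p : vec) : vec :=
  [ffun j => msym s (p ((s^-1)%g j))].

Definition block (sg : 'I_4 -> mon) (p : vec) (m : mon) : blk :=
  [ffun i => ('X_[sg i] * p i)@_m].

(** With shifts of equal degree, taking [Q] to be a single degree encodes homogeneity of the
    entries. *)
Definition blockspace (sg : 'I_4 -> mon) (Q : pred mon) (W : mon -> blk -> Prop)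
    (p : vec) : Prop :=
  forall m, if Q m then W m (block sg p m) else block sg p m = 0.

Definition signed_basis (S : vec -> Prop) : Prop :=
  exists (J : finType) (P : pred J) (xi : J -> vec),
  [/\ forall j, P j -> S (xi j),
      forall b, \sum_(j | P j) b j *: xi j = 0 -> forall j, P j -> b j = 0,
      forall p, S p -> exists b, p = \sum_(j | P j) b j *: xi j
    & forall s j, P j -> exists j' (e : bool),
        P j' /\ vact s (xi j) = (-1) ^+ e *: xi j'].

(** Three slots suffice, since no space of blocks used here exceeds dimension three. Relating the
    families at [m#s] and [m] in the last clause replaces a choice of orbit representatives; when
    [s] fixes [m], it says that the stabilizer permutes the family up to sign. *)
Definition local_basis (Q : pred mon) (W : mon -> blk -> Prop) : Prop :=
  exists (dm : mon -> nat) (f : mon -> 'I_3 -> blk),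
  [/\ forall m (t : 'I_3), Q m -> (t < dm m)%N -> W m (f m t),
      forall m b, Q m -> \sum_(t < 3 | (t < dm m)%N) b t *: f m t = 0 ->
        forall t : 'I_3, (t < dm m)%N -> b t = 0,
      forall m c, Q m -> W m c ->
        exists b, c = \sum_(t < 3 | (t < dm m)%N) b t *: f m t
    & forall (s : 'S_4) (m : mon) (t : 'I_3), Q m -> (t < dm (m#s))%N ->
        exists (t' : 'I_3) (e : bool), (t' < dm m)%N /\
          forall i, f (m#s) t i = (-1) ^+ e * f m t' (s i)].

Definition perm_inv (Q : pred mon) := forall (m : mon) (s : 'S_4), Q (m#s) = Q m.

Lemma local_basis_cases (A Q : pred mon) W : perm_inv A ->
  local_basis (predI Q A) W -> local_basis (predD Q A) W -> local_basis Q W.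
Proof.
move=> invA [d1 [f1 [W1 i1 g1 s1]]] [d2 [f2 [W2 i2 g2 s2]]].
exists (fun m => if A m then d1 m else d2 m).
exists (fun m => if A m then f1 m else f2 m); split.
- move=> m t Qm; case: ifP => Am; [apply: W1|apply: W2] => //=; first by apply/andP.
  by apply/andP; rewrite Am.
- move=> m b Qm; case: ifP => Am; [apply: i1|apply: i2] => //=; first by apply/andP.
  by apply/andP; rewrite Am.
- move=> m c Qm; case: ifP => Am; [apply: g1|apply: g2] => //=; first by apply/andP.
  by apply/andP; rewrite Am.
- move=> s m t Qm; rewrite invA.
  case: ifP => Am; [apply: s1|apply: s2] => //=; first by apply/andP.
  by apply/andP; rewrite Am.
Qed.

Lemma local_basis_ext (Q Q' : pred mon) (W W' : mon -> blk -> Prop) :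
    (forall m, Q m = Q' m) -> (forall m c, Q m -> W m c <-> W' m c) ->
  local_basis Q W -> local_basis Q' W'.
Proof.
move=> eQ eW [d [f [Wf ind gen sgn]]]; exists d, f; split.
- by move=> m t; rewrite -eQ => Qm lt; apply/(eW _ _ Qm)/Wf.
- by move=> m b; rewrite -eQ; apply: ind.
- by move=> m c; rewrite -eQ => Qm /(eW _ _ Qm); apply: gen.
- by move=> s m t; rewrite -eQ; apply: sgn.
Qed.

Lemma local_basis_zero (Q : pred mon) (W : mon -> blk -> Prop) :
  (forall m c, Q m -> W m c -> c = 0) -> local_basis Q W.
Proof.
move=> W0; exists (fun=> 0%N), (fun _ _ => 0); split => //.
by move=> m c Qm /(W0 _ _ Qm) ->; exists (fun=> 0); rewrite big_pred0.
Qed.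

Definition shift_equivariant (sg : 'I_4 -> mon) :=
  forall (s : 'S_4) i, (sg (s i)) # s = sg i.

Lemma mpermB (m1 m2 : mon) (s : 'S_4) : ((m1 - m2)%MM)#s = (m1#s - m2#s)%MM.
Proof. by apply/mnmP=> i; rewrite !mnmE. Qed.

Lemma block_vact sg s p m i : shift_equivariant sg ->
  block sg (vact s p) m (s i) = block sg p (m#s) i.
Proof.
move=> eqv; rewrite !ffunE permK.
by rewrite -mcoeff_sym msymM msymX -(eqv s i) mpermKV.
Qed.

Lemma block_inj sg p q : (forall m, block sg p m = block sg q m) -> p = q.
Proof.
move=> e; apply/ffunP => i; apply/mpolyP => m.
have /ffunP/(_ i) := e (sg i + m)%MM.
by rewrite !ffunE ![_ * p i]mulrC ![_ * q i]mulrC !mcoeffMX.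
Qed.

Lemma blockD sg m p q : block sg (p + q) m = block sg p m + block sg q m.
Proof. by apply/ffunP=> i; rewrite !ffunE mulrDr mcoeffD. Qed.

Lemma blockZ sg m a p : block sg (a *: p) m = a *: block sg p m.
Proof. by apply/ffunP=> i; rewrite !ffunE -scalerAr mcoeffZ. Qed.

Lemma block0 sg m : block sg 0 m = 0.
Proof. by apply/ffunP=> i; rewrite !ffunE mulr0 mcoeff0. Qed.

Lemma block_sum sg m (J : finType) (P : pred J) (F : J -> vec) :
  block sg (\sum_(j | P j) F j) m = \sum_(j | P j) block sg (F j) m.
Proof.
exact: (big_morph (fun p => block sg p m) (fun p q => blockD sg m p q) (block0 sg m)).
Qed.

Definition atom (sg : 'I_4 -> mon) (m : mon) (c : blk) : vec :=
  [ffun i => c i *: 'X_[(m - sg i)%MM]].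

(** Subtraction of multi-exponents is truncated, so an atom is meaningful only at indices whose
    shift divides [m]; the hypothesis kills the other entries. *)
Lemma block_atom sg m (c : blk) m' : (forall i, ~~ (sg i <= m)%MM -> c i = 0) ->
  block sg (atom sg m c) m' = (m == m')%:R *: c.
Proof.
move=> h; apply/ffunP => i; rewrite !ffunE -scalerAr mcoeffZ -mpolyXD mcoeffX.
have [le|nle] := boolP (sg i <= m)%MM; last by rewrite h // mul0r scaler0.
by rewrite addmC submK // [RHS]mulrC.
Qed.

Lemma signed_basis_of_local sg (Q : pred mon) W D :
  shift_equivariant sg -> perm_inv Q -> (forall m, Q m -> mdeg m = D) ->
  (forall m, Q m -> W m 0) ->
  (forall m (c : blk), Q m -> W m c -> forall i, ~~ (sg i <= m)%MM -> c i = 0) ->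
  local_basis Q W -> signed_basis (blockspace sg Q W).
Proof.
move=> eqv invQ degQ W0 Wsg [dm [f [Wf ind gen sgn]]].
pose J : finType := ('X_{1..4 < D.+1} * 'I_3)%type.
pose P (j : J) := Q j.1 && (j.2 < dm j.1)%N.
pose xi (j : J) : vec := atom sg j.1 (f j.1 j.2).
have bxi j m : P j -> block sg (xi j) m = ((j.1 : mon) == m)%:R *: f j.1 j.2.
  by case/andP=> Qj lt; apply: block_atom => i; apply: Wsg => //; apply: Wf.
have bsum b m : block sg (\sum_(j | P j) b j *: xi j) m =
    \sum_(j | P j) (b j * ((j.1 : mon) == m)%:R) *: f j.1 j.2.
  rewrite block_sum; apply: eq_bigr => j Pj.
  by rewrite blockZ bxi // scalerA.
have bsumQ (b : J -> R) (m : mon) (lt : (mdeg m < D.+1)%N) : Q m ->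
    \sum_(j | P j) (b j * ((j.1 : mon) == m)%:R) *: f j.1 j.2 =
    \sum_(t < 3 | (t < dm m)%N) b (BMultinom lt, t) *: f m t.
  move=> Qm.
  transitivity (\sum_(m' : 'X_{1..4 < D.+1} | Q m') \sum_(t < 3 | (t < dm m')%N)
    (b (m', t) * ((m' : mon) == m)%:R) *: f m' t).
    by rewrite pair_big_dep; apply: eq_bigr => -[].
  rewrite (bigD1 (BMultinom lt)) //= [X in _ + X]big1 ?addr0.
    by apply: eq_bigr => t _; rewrite eqxx mulr1.
  move=> m' /andP[_ ne]; apply: big1 => t _.
  by rewrite (_ : (_ == m) = false) ?mulr0 ?scale0r //; apply: negbTE.
have bsumN (b : J -> R) (m : mon) : ~~ Q m ->
    \sum_(j | P j) (b j * ((j.1 : mon) == m)%:R) *: f j.1 j.2 = 0.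
  move=> Qm; apply: big1 => j /andP[Qj _].
  by rewrite (_ : (_ == _) = false) ?mulr0 ?scale0r //; apply: contraNF Qm => /eqP <-.
exists J, P, xi; split.
- move=> j Pj m; rewrite bxi //; case/andP: Pj => Qj lt.
  case: ifP => Qm; have [e|ne] := eqVneq (j.1 : mon) m.
  + by rewrite scale1r -e; apply: Wf.
  + by rewrite scale0r; apply: W0.
  + by rewrite -e Qj in Qm.
  + by rewrite scale0r.
- move=> b b0 [m t] /andP[/= Qm lt].
  have ltm : (mdeg (m : mon) < D.+1)%N by rewrite degQ.
  have := bsum b m; rewrite b0 block0 (bsumQ b m ltm) // => /esym e.
  by have := ind m _ Qm e t lt; congr (b (_, _) = 0); apply: val_inj.
- move=> p Sp.
  have gen' (m : 'X_{1..4 < D.+1}) : exists b, Q m ->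
      block sg p m = \sum_(t < 3 | (t < dm m)%N) b t *: f m t.
    have := Sp m; case: ifP => Qm => [/(gen _ _ Qm)[b eb]|_]; last by exists (fun=> 0).
    by exists b.
  have [b eb] := fin_all_exists gen'.
  exists (fun j => b j.1 j.2); apply: (@block_inj sg) => m.
  rewrite bsum; have := Sp m; case: ifPn => Qm; last by move=> ->; rewrite bsumN.
  move=> _; have ltm : (mdeg (m : mon) < D.+1)%N by rewrite degQ.
  by rewrite (bsumQ _ m ltm) //=; apply: (eb (BMultinom ltm)).
- move=> s [m t] /andP[/= Qm lt].
  (* The image of the atom at [m] sits at [m#s^-1]. The sign clause of the local basis is used at
     that monomial, which [s] carries back to [m]. *)
  have ltm : (mdeg ((m : mon)#(s^-1)%g) < D.+1)%N by rewrite mdeg_mperm bmdeg.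
  have Qm' : Q ((m : mon)#(s^-1)%g) by rewrite invQ.
  have em := mpermK s (m : mon); rewrite /= in em.
  have lt2 : (t < dm (((m : mon)#(s^-1)%g)#s))%N by rewrite em.
  have [t' [e [lt' et]]] := sgn s _ t Qm' lt2.
  exists (BMultinom ltm, t'), e; split; first by apply/andP.
  apply/ffunP => j; rewrite !ffunE /= msymZ msymX mpermB.
  rewrite -{1}em et permKV -scalerA; congr (_ *: (_ *: 'X_[_ - _])).
  by rewrite -(eqv s (s^-1%g j)) permKV; have := mpermKV s (sg j).
Qed.

End CoefficientModel.

(** * Signed bases at a single monomial *)

Section LocalBases.
Variable R : realFieldType.
Local Notation blk := (blk R).

Definition W_sum (m : mon) (c : blk) : Prop := \sum_i c i = 0.

Definition W_supp (m : mon) (c : blk) : Prop :=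
  \sum_i c i = 0 /\ forall i, m i = 0%N -> c i = 0.

(** This is a line because it is used for monomials with exactly one zero exponent. *)
Definition W_line (m : mon) (c : blk) : Prop := forall i, m i <> 0%N -> c i = 0.

Definition nzeros (m : mon) : nat := (\sum_i (m i == 0))%N.

Lemma nzeros_perm (m : mon) (s : 'S_4) : nzeros (m#s) = nzeros m.
Proof.
rewrite /nzeros [RHS](reindex_inj (@perm_inj _ s)).
by apply: eq_bigr => i _; rewrite mnmE.
Qed.

(** A splitting into two pairs is normalized by the side containing 0, which is [{0, t + 1}]; the
    sign is negative on the other side. *)
Definition split_sign (t : 'I_3) (i : 'I_4) : bool := ~~ ((val i == 0) || (val i == t.+1))%N.

Lemma sum3 (V : nmodType) (k : nat) (F : 'I_3 -> V) :
  \sum_(t < 3 | (t < k)%N) F t =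
  (if (0 < k)%N then F (@Ordinal 3 0 isT) else 0) +
  ((if (1 < k)%N then F (@Ordinal 3 1 isT) else 0) +
   (if (2 < k)%N then F (@Ordinal 3 2 isT) else 0)).
Proof.
rewrite big_mkcond !big_ord_recl big_ord0 Monoid.mulm1 /=.
by congr (_ + (_ + _)); case: ifP => // _; congr F; apply: val_inj.
Qed.

Lemma ord3_ind (P : 'I_3 -> Prop) :
  P (@Ordinal 3 0 isT) -> P (@Ordinal 3 1 isT) -> P (@Ordinal 3 2 isT) -> forall i, P i.
Proof.
move=> p0 p1 p2 [[|[|[|//]]] lt].
- by rewrite (_ : Ordinal lt = @Ordinal 3 0 isT) //; apply: val_inj.
- by rewrite (_ : Ordinal lt = @Ordinal 3 1 isT) //; apply: val_inj.
- by rewrite (_ : Ordinal lt = @Ordinal 3 2 isT) //; apply: val_inj.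
Qed.

(** The six two-element subsets are the three splittings with a choice of side. Hence permutations
    preserve the three sign vectors up to a global sign. *)
Lemma balanced_signs (b : 'I_4 -> bool) : (\sum_i b i = 2)%N ->
  exists (t : 'I_3) (e : bool), forall i, b i = e (+) split_sign t i.
Proof.
rewrite big4 /=.
have pick (t : 'I_3) (e : bool) : b o0 = e (+) split_sign t o0 -> b o1 = e (+) split_sign t o1 ->
    b o2 = e (+) split_sign t o2 -> b o3 = e (+) split_sign t o3 ->
    exists (t : 'I_3) (e : bool), forall i, b i = e (+) split_sign t i.
  by move=> ? ? ? ?; exists t, e; apply: ord4_ind.
move: pick; case: (b o0); case: (b o1); case: (b o2); case: (b o3) => pick // _.
all: by [exact: (pick (@Ordinal 3 0 isT) true)|exact: (pick (@Ordinal 3 1 isT) true)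
 |exact: (pick (@Ordinal 3 2 isT) true)|exact: (pick (@Ordinal 3 0 isT) false)
 |exact: (pick (@Ordinal 3 1 isT) false)|exact: (pick (@Ordinal 3 2 isT) false)].
Qed.

Lemma split_sign_balanced t : (\sum_i split_sign t i = 2)%N.
Proof. by rewrite big4; elim/ord3_ind: t. Qed.

Lemma local_basis_sum (Q : pred mon) : local_basis Q W_sum.
Proof.
exists (fun=> 3%N), (fun _ t => [ffun i => (-1) ^+ split_sign t i]); split.
- by move=> m t _ _; rewrite /W_sum big4 /= !ffunE; elim/ord3_ind: t; rewrite /split_sign /=; ring.
- move=> m b _; rewrite sum3 /= => /ffunP e.
  have [e0 e1 e2 e3] := And4 (e o0) (e o1) (e o2) (e o3).
  move: e0 e1 e2 e3; rewrite !ffunE /split_sign /= /GRing.scale /=.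
  rewrite !expr0 !expr1 => e0 e1 e2 e3 t _.
  by elim/ord3_ind: t; lra.
- move=> m c _; rewrite /W_sum big4 /= => c0.
  (* Together with the all-ones vector, the three sign vectors are orthogonal of squared length 4,
     so coefficients are scalar products divided by 4. *)
  exists (fun t => (\sum_i (-1) ^+ split_sign t i * c i) / 4%:R).
  rewrite sum3 !big4 /split_sign /=; apply/ffunP => i; rewrite !ffunE /GRing.scale /=.
  have c3 : c o3 = - c o0 - c o1 - c o2 by lra.
  by elim/ord4_ind: i => /=; rewrite !expr0 !expr1 c3; field.
- move=> s m t _ _.
  have [t' [e et]] : exists (t' : 'I_3) e, forall i, split_sign t ((s^-1)%g i) = e (+) split_sign t' i.
    apply: balanced_signs; rewrite (reindex_inj (@perm_inj _ s)) -[RHS](split_sign_balanced t).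
    by apply: eq_bigr => i _; rewrite permK.
  exists t', e; split=> // i; rewrite !ffunE.
  by have := et (s i); rewrite permK => ->; rewrite signr_addb.
Qed.

Lemma nzeros_eq1 m : nzeros m = 1%N -> exists l, forall i, (m i == 0%N) = (i == l).
Proof.
rewrite /nzeros; case: (pickP (fun l => m l == 0%N)) => [l ml|m0]; last first.
  by rewrite big1 // => i _; rewrite m0.
rewrite (bigD1 l) //= ml => nz1; exists l => i.
have [->//|ne] := eqVneq i l.
by move: nz1; rewrite (bigD1 i) //=; case: (m i == _).
Qed.

Lemma local_basis_line (Q : pred mon) : (forall m, Q m -> nzeros m = 1%N) -> local_basis Q W_line.
Proof.
move=> Q1; exists (fun=> 1%N), (fun m _ => [ffun i => (m i == 0%N)%:R]); split.
- by move=> m t _ _ i /eqP/negbTE mi; rewrite ffunE mi.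
- move=> m b Qm; rewrite sum3 /= !addr0 => /ffunP e t; rewrite ltnS leqn0 => /eqP t0.
  have -> : t = @Ordinal 3 0 isT by apply: val_inj.
  have [l ml] := nzeros_eq1 (Q1 _ Qm).
  by have := e l; rewrite !ffunE ml eqxx /GRing.scale /= mulr1.
- move=> m c Qm Wc; have [l ml] := nzeros_eq1 (Q1 _ Qm).
  exists (fun=> c l); rewrite sum3 /= !addr0; apply/ffunP => i; rewrite !ffunE /GRing.scale /= ml.
  have [->|ne] := eqVneq i l; first by rewrite mulr1.
  by rewrite mulr0 Wc //; apply/eqP; rewrite ml.
- move=> s m t _ t0; exists t, false; split=> // i.
  by rewrite !ffunE mnmE mul1r.
Qed.

(** On a support of two indices this is the edge vector, oriented by the order of the indices: 1 at
    the smaller, -1 at the larger. *)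
Definition edge_sign (m : mon) (i : 'I_4) : R :=
  if m i == 0%N then 0 else if [exists j : 'I_4, (j < i)%N && (m j != 0%N)] then -1 else 1.

Lemma nzeros_eq2 m : nzeros m = 2%N -> exists k l : 'I_4, [/\ (k < l)%N,
  forall i, (m i != 0%N) = ((i == k) || (i == l)),
  edge_sign m k = 1 & edge_sign m l = -1].
Proof.
rewrite /nzeros big4 /=.
have pick (k l : 'I_4) : (k < l)%N -> m k != 0%N -> m l != 0%N ->
    (forall i, i != k -> i != l -> m i == 0%N) -> exists k l : 'I_4, [/\ (k < l)%N,
  forall i, (m i != 0%N) = ((i == k) || (i == l)), edge_sign m k = 1 & edge_sign m l = -1].
  move=> kl mk ml mi; exists k, l; split=> //.
  - move=> i; have [->|ik] := eqVneq i k; first by rewrite mk.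
    by have [->|il] := eqVneq i l; rewrite ?ml //= mi.
  - rewrite /edge_sign (negbTE mk); case: existsP => // -[j /andP[jk]].
    rewrite mi //; first by apply: contraTneq jk => ->; rewrite ltnn.
    by apply: contraTneq jk => ->; rewrite ltnNge ltnW.
  - rewrite /edge_sign (negbTE ml); case: existsP => // -[].
    by exists k; rewrite kl.
case e0: (m o0 == 0%N); case e1: (m o1 == 0%N); case e2: (m o2 == 0%N);
  case e3: (m o3 == 0%N) => // _.
- by apply: (pick o2 o3); rewrite ?e0 ?e1 ?e2 ?e3 //; elim/ord4_ind.
- by apply: (pick o1 o3); rewrite ?e0 ?e1 ?e2 ?e3 //; elim/ord4_ind.
- by apply: (pick o1 o2); rewrite ?e0 ?e1 ?e2 ?e3 //; elim/ord4_ind.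
- by apply: (pick o0 o3); rewrite ?e0 ?e1 ?e2 ?e3 //; elim/ord4_ind.
- by apply: (pick o0 o2); rewrite ?e0 ?e1 ?e2 ?e3 //; elim/ord4_ind.
- by apply: (pick o0 o1); rewrite ?e0 ?e1 ?e2 ?e3 //; elim/ord4_ind.
Qed.

Lemma sum_supp2 (m : mon) (c : blk) (k l : 'I_4) : (k < l)%N ->
  (forall i, (m i != 0%N) = ((i == k) || (i == l))) ->
  (forall i, m i = 0%N -> c i = 0) -> \sum_i c i = c k + c l.
Proof.
move=> kl mi c0; rewrite (bigD1 k) //= (bigD1 l) /=; last by apply: contraTneq kl => ->; rewrite ltnn.
rewrite big1 ?addr0 // => i /andP[ik il].
by apply: c0; apply/eqP; rewrite -[_ == _]negbK mi (negbTE ik) (negbTE il).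
Qed.

Lemma local_basis_edge (Q : pred mon) : (forall m, Q m -> nzeros m = 2%N) -> local_basis Q W_supp.
Proof.
move=> Q2; exists (fun=> 1%N), (fun m _ => [ffun i => edge_sign m i]); split.
- move=> m t Qm _; have [k [l [kl mi sk sl]]] := nzeros_eq2 (Q2 _ Qm); split.
    rewrite (sum_supp2 kl mi) ?ffunE ?sk ?sl ?subrr //.
    by move=> i mi0; rewrite ffunE /edge_sign mi0.
  by move=> i mi0; rewrite ffunE /edge_sign mi0.
- move=> m b Qm; rewrite sum3 /= !addr0 => /ffunP e t; rewrite ltnS leqn0 => /eqP t0.
  have -> : t = @Ordinal 3 0 isT by apply: val_inj.
  have [k [l [kl mi sk sl]]] := nzeros_eq2 (Q2 _ Qm).
  by have := e k; rewrite !ffunE sk /GRing.scale /= mulr1.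
- move=> m c Qm [c0 cs]; have [k [l [kl mi sk sl]]] := nzeros_eq2 (Q2 _ Qm).
  have {}c0 : c k + c l = 0 by rewrite -(sum_supp2 kl mi).
  exists (fun=> c k); rewrite sum3 /= !addr0; apply/ffunP => i; rewrite !ffunE /GRing.scale /=.
  have [mi0|mi0] := eqVneq (m i) 0%N; first by rewrite cs // /edge_sign mi0 mulr0.
  move: mi0; rewrite mi => /orP[] /eqP ->; rewrite ?sk ?sl; lra.
- move=> s m t Qm t0.
  have [k [l [kl mi sk sl]]] := nzeros_eq2 (Q2 _ Qm).
  have [k' [l' [kl' mi' sk' sl']]] : exists k l : 'I_4, [/\ (k < l)%N,
    forall i, ((m#s) i != 0%N) = ((i == k) || (i == l)),
    edge_sign (m#s) k = 1 & edge_sign (m#s) l = -1].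
    by apply: nzeros_eq2; rewrite nzeros_perm; apply: Q2.
  have kl'n : k' != l' by apply: contraTneq kl' => ->; rewrite ltnn.
  have := mi' k'; rewrite mnmE mi eqxx => /orP hk.
  have := mi' l'; rewrite mnmE mi eqxx orbT => /orP hl.
  (* The orientation is reversed exactly when [s] sends the smaller endpoint [k'] to the larger
     endpoint [l]. *)
  exists t, (s k' == l); split=> // i; rewrite !ffunE.
  have [mi0|mi0] := eqVneq ((m#s) i) 0%N.
    by rewrite /edge_sign mi0; move: mi0; rewrite mnmE => ->; rewrite mulr0.
  have lk : l != k by apply: contraTneq kl => ->; rewrite ltnn.
  have ss : s k' != s l' by rewrite (inj_eq perm_inj).
  move: mi0; rewrite mi' => /orP[] /eqP ->.
    case: hk => /eqP ->; rewrite sk' ?sk ?sl; last by rewrite eqxx; ring.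
    by rewrite eq_sym (negbTE lk); ring.
  case: hk hl ss => /eqP -> [] /eqP ->; rewrite ?eqxx // => _; rewrite sl' ?sk ?sl.
    by rewrite eq_sym (negbTE lk); ring.
  by ring.
Qed.

End LocalBases.

(** * The sum-zero plane of a face *)

Section FaceBasis.
Variable R : realFieldType.
Local Notation blk := (blk R).

(** The first vector is three times the centred exponent vector, which avoids a division. Putting
    the indicator of the zero exponent in the first row makes the 4 by 4 determinant a cross product
    on the face without choosing coordinates there; it changes by the signature under
    permutations. *)
Definition face_vec (m : mon) (t : 'I_3) : blk := [ffun i =>
  if t == 0%N :> nat then (m i != 0%N)%:R * (3 * (m i)%:R - (mdeg m)%:R)
  else det4 (fun j => (m j == 0%N)%:R) (fun j => (i == j)%:R)
            (fun j => (m j)%:R) (fun=> 1)].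

(** The two vectors are orthogonal, of squared lengths [3 N] and [N] with [N] the sum of squared
    differences; pairing the relation with each of them isolates [s] and [t]. The coefficients in
    [face_gen] are the same projections. *)
Lemma face_indep (a b c s t : R) : (b - c)^+2 + (c - a)^+2 + (a - b)^+2 != 0 ->
  s * (2 * a - b - c) + t * (b - c) = 0 ->
  s * (2 * b - a - c) + t * (c - a) = 0 ->
  s * (2 * c - a - b) + t * (a - b) = 0 -> s = 0 /\ t = 0.
Proof.
move=> N0 e1 e2 e3.
have es : s * (3 * ((b - c)^+2 + (c - a)^+2 + (a - b)^+2)) = 0.
  transitivity ((2 * a - b - c) * (s * (2 * a - b - c) + t * (b - c)) +
    (2 * b - a - c) * (s * (2 * b - a - c) + t * (c - a)) +
    (2 * c - a - b) * (s * (2 * c - a - b) + t * (a - b))); first by ring.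
  by rewrite e1 e2 e3; ring.
have et : t * ((b - c)^+2 + (c - a)^+2 + (a - b)^+2) = 0.
  transitivity ((b - c) * (s * (2 * a - b - c) + t * (b - c)) +
    (c - a) * (s * (2 * b - a - c) + t * (c - a)) +
    (a - b) * (s * (2 * c - a - b) + t * (a - b))); first by ring.
  by rewrite e1 e2 e3; ring.
split.
  by move/eqP: es; rewrite !mulf_eq0 (negbTE N0) pnatr_eq0 !orbF => /eqP.
by move/eqP: et; rewrite !mulf_eq0 (negbTE N0) !orbF => /eqP.
Qed.

Lemma face_gen (a b c x y z : R) : (b - c)^+2 + (c - a)^+2 + (a - b)^+2 != 0 ->
  x + y + z = 0 -> exists s t : R,
  [/\ x = s * (2 * a - b - c) + t * (b - c),
      y = s * (2 * b - a - c) + t * (c - a)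
    & z = s * (2 * c - a - b) + t * (a - b)].
Proof.
move=> N0 e; have {e} -> : z = - x - y by lra.
exists (((2 * a - b - c) * x + (2 * b - a - c) * y + (2 * c - a - b) * (- x - y)) /
  (3 * ((b - c)^+2 + (c - a)^+2 + (a - b)^+2))).
exists (((b - c) * x + (c - a) * y + (a - b) * (- x - y)) /
  ((b - c)^+2 + (c - a)^+2 + (a - b)^+2)).
by split; field; rewrite N0.
Qed.

Lemma face_neq (a b c : nat) : ~~ (3 %| a + b + c)%N ->
  (b%:R - c%:R)^+2 + (c%:R - a%:R)^+2 + (a%:R - b%:R)^+2 != 0 :> R.
Proof.
apply: contra => /eqP e.
have e1 : (b%:R - c%:R)^+2 = 0 :> R.
  by have := sqr_ge0 (b%:R - c%:R : R); have := sqr_ge0 (c%:R - a%:R : R);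
     have := sqr_ge0 (a%:R - b%:R : R); lra.
have e2 : (a%:R - b%:R)^+2 = 0 :> R.
  by have := sqr_ge0 (b%:R - c%:R : R); have := sqr_ge0 (c%:R - a%:R : R);
     have := sqr_ge0 (a%:R - b%:R : R); lra.
move/eqP: e1; rewrite sqrf_eq0 subr_eq0 eqr_nat => /eqP <-.
move/eqP: e2; rewrite sqrf_eq0 subr_eq0 eqr_nat => /eqP ->.
by apply/dvdnP; exists b; lia.
Qed.

(* On a face, the sum-zero plane is spanned by the projection of the exponent
   vector and by its cross product with [(1, 1, 1)]; the exponents not being
   all equal, neither vanishes, and permutations preserve them up to sign. *)
Lemma local_basis_face (Q : pred mon) :
  (forall m, Q m -> nzeros m = 1%N /\ ~~ (3 %| mdeg m)%N) -> local_basis Q (@W_supp R).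
Proof.
move=> Q1; exists (fun=> 2%N), face_vec.
have Q1' m : Q m -> exists l, (forall i, (m i == 0%N) = (i == l)) /\ ~~ (3 %| mdeg m)%N.
  by move=> /Q1[/nzeros_eq1[l ml] nd]; exists l.
split.
- move=> m t Qm _; have [l [ml nd]] := Q1' _ Qm; have := ml l; rewrite eqxx => /eqP ml0.
  split=> [|i /eqP mi]; rewrite ?big4 /= !ffunE; case: ifP => _; rewrite ?det4E.
  + rewrite !ml mdegE big4 /= !natrD; elim/ord4_ind: l ml ml0 => ml -> /=; ring.
  + rewrite /= !ml; elim/ord4_ind: l ml ml0 => ml -> /=; ring.
  + by rewrite mi mul0r.
  + move: mi; rewrite ml => /eqP ->; rewrite /= !ml.
    elim/ord4_ind: l ml ml0 => ml -> /=; ring.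
- move=> m b Qm; rewrite sum3 /= addr0 => /ffunP e.
  have [l [ml nd]] := Q1' _ Qm; have := ml l; rewrite eqxx => /eqP ml0.
  have [e0 e1 e2 e3] := And4 (e o0) (e o1) (e o2) (e o3).
  have : b (@Ordinal 3 0 isT) = 0 /\ b (@Ordinal 3 1 isT) = 0.
    move: e0 e1 e2 e3; rewrite !ffunE /GRing.scale /= !det4E /= !ml mdegE big4 /= !natrD.
    move: nd; rewrite mdegE big4 /= => nd.
    elim/ord4_ind: l ml ml0 => ml ml0 /=; rewrite ml0 /= => e0 e1 e2 e3.
    + by apply: (@face_indep (m o1)%:R (m o2)%:R (m o3)%:R); [apply: face_neq; move: nd; rewrite ml0 add0n addnA|lra..].
    (* The cofactor sign alternates with [l], so for odd [l] the last two exponents are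
       exchanged. *)
    + by apply: (@face_indep (m o0)%:R (m o3)%:R (m o2)%:R); [apply: face_neq; move: nd; apply: contra => h; lia|lra..].
    + by apply: (@face_indep (m o0)%:R (m o1)%:R (m o3)%:R); [apply: face_neq; move: nd; apply: contra => h; lia|lra..].
    + by apply: (@face_indep (m o0)%:R (m o2)%:R (m o1)%:R); [apply: face_neq; move: nd; apply: contra => h; lia|lra..].
  by move=> [b0 b1] t; elim/ord3_ind: t.
- move=> m c Qm [c0 cs].
  have [l [ml nd]] := Q1' _ Qm; have := ml l; rewrite eqxx => /eqP ml0.
  move: c0 nd; rewrite mdegE !big4 /= => c0 nd.
  have cl : c l = 0 by apply: cs.
  elim/ord4_ind: l ml ml0 cl => ml ml0 cl; rewrite cl in c0; rewrite ml0 in nd.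
  + have N0 : ((m o2)%:R - (m o3)%:R)^+2 + ((m o3)%:R - (m o1)%:R)^+2 +
        ((m o1)%:R - (m o2)%:R)^+2 != 0 :> R.
      by apply: face_neq; move: nd; apply: contra => h; lia.
    have [|a [b [ex ey ez]]] := @face_gen _ _ _ (c o1) (c o2) (c o3) N0; first by lra.
    exists (fun t => if t == 0%N :> nat then a else b); apply/ffunP => i.
    rewrite sum3 /= addr0 !ffunE /GRing.scale /= det4E /= !ml mdegE big4 /= !natrD ml0.
    by elim/ord4_ind: i => /=; rewrite ?ex ?ey ?ez ?cl; ring.
  + have N0 : ((m o3)%:R - (m o2)%:R)^+2 + ((m o2)%:R - (m o0)%:R)^+2 +
        ((m o0)%:R - (m o3)%:R)^+2 != 0 :> R.
      by apply: face_neq; move: nd; apply: contra => h; lia.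
    have [|a [b [ex ey ez]]] := @face_gen _ _ _ (c o0) (c o3) (c o2) N0; first by lra.
    exists (fun t => if t == 0%N :> nat then a else b); apply/ffunP => i.
    rewrite sum3 /= addr0 !ffunE /GRing.scale /= det4E /= !ml mdegE big4 /= !natrD ml0.
    by elim/ord4_ind: i => /=; rewrite ?ex ?ey ?ez ?cl; ring.
  + have N0 : ((m o1)%:R - (m o3)%:R)^+2 + ((m o3)%:R - (m o0)%:R)^+2 +
        ((m o0)%:R - (m o1)%:R)^+2 != 0 :> R.
      by apply: face_neq; move: nd; apply: contra => h; lia.
    have [|a [b [ex ey ez]]] := @face_gen _ _ _ (c o0) (c o1) (c o3) N0; first by lra.
    exists (fun t => if t == 0%N :> nat then a else b); apply/ffunP => i.
    rewrite sum3 /= addr0 !ffunE /GRing.scale /= det4E /= !ml mdegE big4 /= !natrD ml0.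
    by elim/ord4_ind: i => /=; rewrite ?ex ?ey ?ez ?cl; ring.
  + have N0 : ((m o2)%:R - (m o1)%:R)^+2 + ((m o1)%:R - (m o0)%:R)^+2 +
        ((m o0)%:R - (m o2)%:R)^+2 != 0 :> R.
      by apply: face_neq; move: nd; apply: contra => h; lia.
    have [|a [b [ex ey ez]]] := @face_gen _ _ _ (c o0) (c o2) (c o1) N0; first by lra.
    exists (fun t => if t == 0%N :> nat then a else b); apply/ffunP => i.
    rewrite sum3 /= addr0 !ffunE /GRing.scale /= det4E /= !ml mdegE big4 /= !natrD ml0.
    by elim/ord4_ind: i => /=; rewrite ?ex ?ey ?ez ?cl; ring.
- move=> s m t _ t2; exists t, (if t == 0%N :> nat then false else s : bool); split=> // i.
  rewrite !ffunE; case: ifP => _.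
    by rewrite !mnmE mdeg_mperm mul1r.
  rewrite -det4_perm /det4; congr (\det _); apply/matrixP => j k; rewrite !mxE.
  by elim/ord4_ind: j; rewrite /= ?mnmE // (inj_eq perm_inj).
Qed.
End FaceBasis.

(** * The trace obstruction *)

Section Obstruction.
Variable R : realFieldType.
Local Notation blk := (blk R).

Definition cyc3_fun (i : 'I_4) : 'I_4 :=
  match val i with 0%N => o1 | 1%N => o2 | 2%N => o0 | _ => o3 end.

Lemma cyc3_fun_inj : injective cyc3_fun.
Proof.
apply: (can_inj (g := cyc3_fun \o cyc3_fun)).
by elim/ord4_ind; apply: val_inj.
Qed.

Definition cyc3 : 'S_4 := perm cyc3_fun_inj.

Lemma cyc3E : [/\ cyc3 o0 = o1, cyc3 o1 = o2, cyc3 o2 = o0 & cyc3 o3 = o3].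
Proof. by split; rewrite permE. Qed.

Lemma cyc3_order i : cyc3 (cyc3 (cyc3 i)) = i.
Proof. by case: cyc3E => e0 e1 e2 e3; elim/ord4_ind: i; rewrite ?(e0, e1, e2, e3). Qed.

(** Base index for the spanning vectors [delta i - delta (first_supp m)] of the sum-zero space on
    the support of [m]. The default occurs only for the zero monomial. *)
Definition first_supp (m : mon) : 'I_4 := odflt o0 [pick i | m i != 0%N].

Lemma first_suppP m : (0 < mdeg m)%N -> m (first_supp m) != 0%N.
Proof.
rewrite /first_supp; case: pickP => //= h.
by rewrite mdegE big1 // => i _; apply/eqP; rewrite -[_ == _]negbK (h i).
Qed.

Definition delta (i : 'I_4) : blk := [ffun k => (i == k)%:R].

Lemma sum_delta i : \sum_k delta i k = 1.
Proof.
rewrite (bigD1 i) //= big1 ?addr0 ?ffunE ?eqxx // => k ki.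
by rewrite ffunE eq_sym (negbTE ki).
Qed.

Lemma blk_scaleE (a : R) (c : blk) k : (a *: c) k = a * c k.
Proof. by rewrite ffunE. Qed.

Lemma blk_subE (c d : blk) k : (c - d) k = c k - d k.
Proof. by rewrite !ffunE. Qed.

Lemma deltaE i k : delta i k = (i == k)%:R.
Proof. by rewrite ffunE. Qed.

(* The trace of a 3-cycle on the block space is the sum over the monomials
   [m] it fixes of [m_3 <> 0] - 1, hence negative; on a signed permutation
   basis it is the number of fixed basis elements, since a sign [e] with
   [e ^ 3 = 1] is [1]. *)
Lemma no_signed_basis (sg : 'I_4 -> mon) (q : nat) : shift_equivariant sg ->
  (forall (m : mon) i, m i != 0%N -> (sg i <= m)%MM) -> (0 < q)%N ->
  ~ signed_basis (blockspace sg [pred m : mon | mdeg m == 3 * q]%N (@W_supp R)).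
Proof.
move=> eqv sgle q0 [J [P [xi [xiS ind gen sgn]]]].
set D := (3 * q)%N in xiS gen; set g := cyc3.
pose B j m : blk := block sg (xi j) m.
have [pi_e hpe] : exists pe : J -> J * bool, forall j, P j ->
    P (pe j).1 /\ vact g (xi j) = (-1) ^+ (pe j).2 *: xi (pe j).1.
  apply: (fin_all_exists (P := fun j (je : J * bool) => P j ->
    P je.1 /\ vact g (xi j) = (-1) ^+ je.2 *: xi je.1)) => j.
  case Pj: (P j); last by exists (j, false).
  by have [j' [e h]] := sgn g j Pj; exists (j', e).
pose pj j := (pi_e j).1; pose ej j := (pi_e j).2.
have Ppj j : P j -> P (pj j) by case/hpe.
have Bact j m i : P j -> B j (m#g) i = (-1) ^+ ej j * B (pj j) m (g i).
  move=> Pj; rewrite /B -(block_vact _ _ _ _ eqv) (proj2 (hpe j Pj)) blockZ.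
  by rewrite blk_scaleE.
have Bdeg j (m : mon) : P j -> mdeg m != D -> B j m = 0.
  by move=> Pj /negbTE nD; have := xiS j Pj m; rewrite inE nD.
have BS j (m : mon) : P j -> mdeg m = D -> W_supp m (B j m).
  by move=> Pj mD; have := xiS j Pj m; rewrite inE mD eqxx.
(* This family is redundant, being zero at the base index, but a sum-zero block is the combination
   of it whose coefficients are just the entries of the block. The trace can therefore be computed
   without a basis of each block. *)
pose dlt (y : mon) i : blk := delta i - delta (first_supp y).
have D0 : (0 < D)%N by rewrite muln_gt0.
have dltS (y : mon) i : mdeg y = D -> y i != 0%N -> W_supp y (dlt y i).
  move=> yD yi; split.
    rewrite -[RHS](subrr 1) -{1}(sum_delta i) -(sum_delta (first_supp y)) -sumrB.
    by apply: eq_bigr => k _; rewrite !ffunE.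
  move=> k yk; rewrite !ffunE.
  have -> : (i == k) = false by apply: contraNF yi => /eqP ->; rewrite yk.
  have -> : (first_supp y == k) = false.
    by apply: contraTF (first_suppP (m := y) _) => [/eqP ->|]; rewrite ?yk ?yD.
  by rewrite subrr.
have dltat (y m : mon) i : mdeg y = D -> y i != 0%N ->
    block sg (atom sg y (dlt y i)) m = (y == m)%:R *: dlt y i.
  move=> yD yi; apply: block_atom => k nk; apply: (proj2 (dltS y i yD yi)).
  by apply/eqP; apply: contraNT nk; apply: sgle.
have [B' hB'] : exists B' : 'X_{1..4 < D.+1} * 'I_4 -> J -> R, forall z : 'X_{1..4 < D.+1} * 'I_4, mdeg (z.1 : mon) = D ->
    (z.1 : mon) z.2 != 0%N -> atom sg z.1 (dlt z.1 z.2) = \sum_(j | P j) B' z j *: xi j.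
  apply: (fin_all_exists (P := fun (z : 'X_{1..4 < D.+1} * 'I_4) (b : J -> R) => mdeg (z.1 : mon) = D ->
    (z.1 : mon) z.2 != 0%N -> atom sg z.1 (dlt z.1 z.2) = \sum_(j | P j) b j *: xi j)).
  move=> [y i] /=; case: (eqVneq (mdeg (y : mon)) D) => yD; last by exists (fun=> 0) => e; case/eqP: yD.
  case yi: ((y : mon) i == 0%N); first by exists (fun=> 0).
  move/negbT: yi => yi.
  have [|b eb] := gen (atom sg y (dlt y i)); last by exists b.
  move=> m; rewrite inE; case: eqP => mD; rewrite dltat //.
    case: eqP => [<-|_]; first by rewrite scale1r; apply: dltS.
    by rewrite scale0r; split=> [|k _]; rewrite ?ffunE // big1 // => k _; rewrite ffunE.
  by case: eqP => [em|_]; [rewrite -em in mD|rewrite scale0r].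
pose Z (z : 'X_{1..4 < D.+1} * 'I_4) := (mdeg (z.1 : mon) == D) && ((z.1 : mon) z.2 != 0%N).
have B'B z m k : Z z -> \sum_(j | P j) B' z j * B j m k =
    ((z.1 : mon) == m)%:R * dlt z.1 z.2 k.
  case/andP=> /eqP zD zn; have := dltat _ m _ zD zn; rewrite hB' // block_sum => /ffunP/(_ k).
  rewrite blk_scaleE => <-; rewrite sum_ffunE.
  by apply: eq_bigr => j _; rewrite blockZ blk_scaleE.
have sumZ (V : nmodType) (F : mon -> 'I_4 -> V) (m : mon) : mdeg m = D ->
    \sum_(z : 'X_{1..4 < D.+1} * 'I_4 | Z z) (if (z.1 : mon) == m then F z.1 z.2 else 0) =
    \sum_(i | m i != 0%N) F m i.
  move=> mD; have lt : (mdeg m < D.+1)%N by rewrite mD.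
  transitivity (\sum_(y : 'X_{1..4 < D.+1} | mdeg (y : mon) == D) \sum_(i | (y : mon) i != 0%N)
    (if (y : mon) == m then F y i else 0)).
    by rewrite pair_big_dep; apply: eq_bigr => -[].
  rewrite (bigD1 (BMultinom lt)) /= ?mD ?eqxx // [X in _ + X]big1 ?addr0 //.
  by move=> y /andP[_ ne]; apply: big1 => i _; rewrite ifN.
(* Expanding [xi j] in the redundant family and then returning to the basis is the identity;
   independence of [xi] makes this an identity of matrices. *)
have BB' j k : P j -> P k -> \sum_(z : 'X_{1..4 < D.+1} * 'I_4 | Z z) B j z.1 z.2 * B' z k = (j == k)%:R.
  move=> Pj Pk.
  have e1 : xi j = \sum_(z : 'X_{1..4 < D.+1} * 'I_4 | Z z) B j z.1 z.2 *: atom sg z.1 (dlt z.1 z.2).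
    apply: (@block_inj _ sg) => m; apply/ffunP => l; rewrite block_sum sum_ffunE.
    transitivity (\sum_(z : 'X_{1..4 < D.+1} * 'I_4 | Z z) (if (z.1 : mon) == m then B j z.1 z.2 * dlt z.1 z.2 l else 0)).
      rewrite -/(B j m).
      have [mD|mD] := eqVneq (mdeg m) D; last first.
        rewrite Bdeg // ffunE big1 // => z /andP[/eqP zD _].
        by rewrite ifN //; apply: contraNneq mD => <-; apply/eqP.
      rewrite (sumZ _ (fun y i => B j y i * dlt y i l)) //.
      have [B0 Bs] := BS _ _ Pj mD.
      transitivity (\sum_i B j m i * dlt m i l).
        transitivity (\sum_i B j m i * (delta i l) - (\sum_i B j m i) * delta (first_supp m) l).
          rewrite B0 mul0r subr0 (bigD1 l) //= big1 ?addr0 ?deltaE ?eqxx ?mulr1 //.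
          by move=> i il; rewrite deltaE (negbTE il) mulr0.
        rewrite mulr_suml -sumrB; apply: eq_bigr => i _.
        by rewrite blk_subE mulrBr.
      rewrite [RHS]big_mkcond; apply: eq_bigr => i _.
      by case: eqP => // mi; rewrite Bs ?mul0r.
    apply: eq_bigr => z /andP[/eqP zD zn]; rewrite blockZ dltat // !blk_scaleE.
    by case: eqP => _; rewrite ?mul1r // mul0r mulr0.
  have e2 : \sum_(k | P k) (\sum_(z : 'X_{1..4 < D.+1} * 'I_4 | Z z) B j z.1 z.2 * B' z k - (j == k)%:R) *: xi k = 0.
    transitivity (\sum_(k | P k) (\sum_(z : 'X_{1..4 < D.+1} * 'I_4 | Z z)
        B j z.1 z.2 * B' z k) *: xi k - \sum_(k | P k) (j == k)%:R *: xi k).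
      by rewrite -sumrB; apply: eq_bigr => l _; rewrite scalerBl.
    apply/eqP; rewrite subr_eq0; apply/eqP; transitivity (xi j); last first.
      rewrite (bigD1 j) //= eqxx scale1r big1 ?addr0 // => l /andP[_ lj].
      by rewrite eq_sym (negbTE lj) scale0r.
    rewrite e1; under eq_bigr do rewrite scaler_suml.
    rewrite exchange_big /=; apply: eq_bigr => z /andP[/eqP zD zn].
    by rewrite hB' // scaler_sumr; apply: eq_bigr => l _; rewrite scalerA.
  by apply/eqP; rewrite -subr_eq0; apply/eqP; apply: (ind _ e2).
(* The trace of [g] in the basis [xi]: only elements fixed up to sign contribute, each with its
   sign. *)
pose T := \sum_(j | P j) (-1) ^+ ej j * (pj j == j)%:R : R.
have T0 : 0 <= T.
  apply: sumr_ge0 => j Pj; case: eqP => epj; last by rewrite mulr0.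
  rewrite mulr1; case eejj: (ej j) => //; exfalso.
  have Bm m i : B j (m#g) i = - B j m (g i) by rewrite Bact // eejj epj expr1 mulN1r.
  have : (1 : R) = 0.
    have xj0 : xi j = 0.
      apply: (@block_inj _ sg) => m; apply/ffunP => i; rewrite block0 [RHS]ffunE.
      have := Bm (m#g#g) i.
      rewrite (_ : m#g#g#g = m); last by apply/mnmP => k; rewrite !mnmE cyc3_order.
      rewrite !Bm cyc3_order.
      rewrite -/(B j m); lra.
    have := ind (fun k => (k == j)%:R) _ j Pj; rewrite eqxx; apply.
    rewrite (bigD1 j) //= xj0 scaler0 add0r big1 // => k /andP[_ /negbTE ->].
    by rewrite scale0r.
  by apply/eqP; rewrite oner_eq0.
(* Cyclicity of the trace: exchanging the two sums gives the trace in the redundant family. *)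
have TE : T = \sum_(z : 'X_{1..4 < D.+1} * 'I_4 | Z z) ((z.1 : mon) == (z.1 : mon)#g)%:R * dlt z.1 z.2 ((g^-1)%g z.2).
  transitivity (\sum_(j | P j) \sum_(z : 'X_{1..4 < D.+1} * 'I_4 | Z z) B' z j * B j ((z.1 : mon)#g) ((g^-1)%g z.2)).
    apply: eq_bigr => j Pj; rewrite -BB' ?Ppj // mulr_sumr; apply: eq_bigr => z _.
    by rewrite Bact // permKV; ring.
  rewrite exchange_big; apply: eq_bigr => z Zz; exact: B'B.
have TE2 : T = \sum_(y : 'X_{1..4 < D.+1} | mdeg (y : mon) == D) (if (y : mon) == (y : mon)#g then
    ((y : mon) o3 != 0%N)%:R - 1 else 0).
  rewrite TE.
  transitivity (\sum_(y : 'X_{1..4 < D.+1} | mdeg (y : mon) == D) \sum_(i | (y : mon) i != 0%N)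
    ((y : mon) == (y : mon)#g)%:R * dlt y i ((g^-1)%g i)).
    by rewrite pair_big_dep; apply: eq_bigr => -[].
  apply: eq_bigr => y /eqP yD; case: eqP => [yg|_]; last by rewrite big1 // => i _; rewrite mul0r.
  have ygi i : (y : mon) (g i) = (y : mon) i.
    by have /mnmP/(_ i) := yg; rewrite mnmE.
  have y0 : (y : mon) (g (first_supp y)) != 0%N by rewrite ygi first_suppP ?yD.
  under eq_bigr do rewrite mul1r blk_subE !deltaE.
  (* The first sum counts the support indices fixed by [g], hence only [o3]. The second has the
     single term [i = g (first_supp y)], which is in the support because [y] is fixed. *)
  rewrite sumrB; congr (_ - _).
    rewrite big_mkcond big4 /=.
    case: cyc3E => e0 e1 e2 e3.
    have gV i k : ((i == (g^-1)%g k) = (g i == k)) by rewrite -(inj_eq (@perm_inj _ g)) permKV.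
    rewrite !gV e0 e1 e2 e3 /= !if_same !add0r.
    by case: ifP.
  rewrite (bigD1 (g (first_supp y))) //= permK eqxx big1 ?addr0 //.
  move=> i /andP[_ ne]; case: eqP => // e.
  by rewrite e permKV eqxx in ne.
have : T < 0.
  (* The monomial [(q, q, q, 0)] is fixed by the cycle and misses [o3], so it contributes -1, and no
     monomial contributes a positive amount. *)
  pose y0 : mon := [multinom if i == o3 then 0%N else q | i < 4].
  have y0D : (mdeg y0 < D.+1)%N by rewrite mdegE big4 /= !mnmE /= /D; lia.
  rewrite TE2 (bigD1 (BMultinom y0D)) /=; last by rewrite mdegE big4 /= !mnmE /= /D; lia.
  rewrite ifT; last first.
    by apply/eqP/mnmP; case: cyc3E => e0 e1 e2 e3; elim/ord4_ind; rewrite !mnmE ?(e0, e1, e2, e3).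
  rewrite mnmE eqxx /= sub0r ltr_wnDr ?oppr_lt0 ?ltr01 //.
  apply: sumr_le0 => y _; case: ifP => // _.
  by case: (_ != _); rewrite ?subrr // sub0r oppr_le0 ler01.
by rewrite ltNge T0.
Qed.

End Obstruction.

(** * Signed bases of the block spaces *)

Section SignedBases.
Variable R : realFieldType.
Local Notation blk := (blk R).

(** The condition for both trace-free spaces [P_r^-]: only monomials of full support carry a
    block. *)
Definition W_full (m : mon) (c : blk) : Prop :=
  \sum_i c i = 0 /\ forall i j, m j = 0%N -> c i = 0.

(** The condition for [P_r^- Lambda^2] and the trace-free [P_r Lambda^1]. With exactly one zero
    exponent, the entry at that index is free; the sum condition, a normalization, is imposed on
    full supports only. *)
Definition W_cofull (m : mon) (c : blk) : Prop :=
  ((forall j, m j <> 0%N) -> \sum_i c i = 0) /\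
  forall i j, i != j -> m j = 0%N -> c i = 0.

Definition of_deg (D : nat) : pred mon := [pred m : mon | mdeg m == D].

Lemma of_deg_perm D : perm_inv (of_deg D).
Proof. by move=> m s; rewrite /of_deg /= mdeg_mperm. Qed.

Lemma nzeros_eq0P (m : mon) : reflect (forall j, m j <> 0%N) (nzeros m == 0%N).
Proof.
rewrite /nzeros sum_nat_eq0; by apply: (iffP forallP) => h j; have := h j; case: (m j).
Qed.

Lemma nzeros_neq0 (m : mon) : nzeros m != 0%N -> exists j, m j = 0%N.
Proof.
move=> h; case: (pickP (fun j => m j == 0%N)) => [j /eqP mj|h']; first by exists j.
by case/negP: h; apply/nzeros_eq0P => j /eqP; rewrite h'.
Qed.

Lemma nzeros_gt1 (m : mon) i : (1 < nzeros m)%N -> exists2 j, i != j & m j = 0%N.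
Proof.
move=> h; case: (pickP (fun j => (i != j) && (m j == 0%N))) => [j /andP[ij /eqP mj]|h'].
  by exists j.
move: h; rewrite /nzeros (bigD1 i) //= big1 ?addn0; first by case: (m i == _).
by move=> j ji; have := h' j; rewrite eq_sym ji /= => ->.
Qed.

Lemma nzeros_inv k : perm_inv [pred m | nzeros m == k].
Proof. by move=> m s; rewrite /= nzeros_perm. Qed.

Lemma local_basis_full (Q : pred mon) : local_basis Q W_full.
Proof.
apply: (local_basis_cases (@nzeros_inv 0)).
  apply: local_basis_ext (local_basis_sum R (predI Q [pred m | nzeros m == 0%N])) => // m c.
  move=> /andP[_ /nzeros_eq0P m0]; split=> [h|[]//]; split=> // i j mj.
  by case: (m0 j).
apply: local_basis_zero => m c /andP[/nzeros_neq0[j mj] _] [_ c0].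
by apply/ffunP => i; rewrite ffunE (c0 i j).
Qed.

Lemma local_basis_cofull (Q : pred mon) : local_basis Q W_cofull.
Proof.
apply: (local_basis_cases (@nzeros_inv 0)).
  apply: local_basis_ext (local_basis_sum R (predI Q [pred m | nzeros m == 0%N])) => // m c.
  move=> /andP[_ /nzeros_eq0P m0]; split=> [h|[h _]]; last exact: h.
  by split=> // i j _ mj; case: (m0 j).
apply: (local_basis_cases (@nzeros_inv 1)).
  apply: local_basis_ext (local_basis_line R (Q := predI (predD Q [pred m | nzeros m == 0%N])
    [pred m | nzeros m == 1%N]) _) => //; last by move=> m /andP[_ /eqP].
  move=> m c /andP[/andP[/nzeros_neq0[j mj] _] /eqP/nzeros_eq1[l ml]]; split=> [h|[_ h] i mi].
    split=> [m0|i k ik mk]; first by case: (m0 j).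
    by apply: h => mi; have := ml k; have := ml i; rewrite mi mk !eqxx => /esym/eqP <-;
       rewrite eq_sym (negbTE ik).
  apply: (h i j) => //; apply: contra_notN mi => /eqP ->; exact: mj.
apply: local_basis_zero => m c /andP[nz1 /andP[nz0 _]] [_ h].
apply/ffunP => i; rewrite ffunE.
have [|j ij mj] := @nzeros_gt1 m i; last exact: (h i j).
by move: nz0 nz1; rewrite /=; case: (nzeros m) => [|[]].
Qed.

Lemma local_basis_supp (Q : pred mon) :
  (forall m, Q m -> nzeros m = 1%N -> ~~ (3 %| mdeg m)%N) -> local_basis Q (@W_supp R).
Proof.
move=> Q3; apply: (local_basis_cases (@nzeros_inv 0)).
  apply: local_basis_ext (local_basis_sum R (predI Q [pred m | nzeros m == 0%N])) => // m c.
  move=> /andP[_ /nzeros_eq0P m0]; split=> [h|[]//].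
  by split=> // i mi; case: (m0 i).
apply: (local_basis_cases (@nzeros_inv 1)).
  apply: local_basis_face => m /andP[/andP[_ Qm] /eqP m1]; split=> //.
  by apply: Q3.
apply: (local_basis_cases (@nzeros_inv 2)).
  by apply: local_basis_edge => m /andP[_ /eqP].
(* At most one exponent is nonzero here, and a sum-zero vector with at most one nonzero entry
   vanishes. *)
apply: local_basis_zero => m c /and4P[n2 n1 n0 _] [c0 cs].
case: (pickP (fun j => m j != 0%N)) => [l ml|m0]; last first.
  by apply/ffunP => i; rewrite ffunE cs //; apply/eqP; have := m0 i; case: (m i == 0%N).
have z i : i != l -> m i = 0%N.
  move: n2 n1 n0 ml; rewrite /= /nzeros !big4; elim/ord4_ind: l;
  case e0: (m o0 == 0%N); case e1: (m o1 == 0%N); case e2: (m o2 == 0%N);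
  case e3: (m o3 == 0%N) => // _ _ _ _; elim/ord4_ind: i => // _; exact/eqP.
have cl i : i != l -> c i = 0 by move=> /z; apply: cs.
apply/ffunP => i; rewrite ffunE; have [->|/cl//] := eqVneq i l.
by move: c0; rewrite (bigD1 l) //= big1 ?addr0 // => k /cl.
Qed.

Definition shift0 (i : 'I_4) : mon := 0%MM.
Definition shift1 (i : 'I_4) : mon := U_(i)%MM.
(** The product of the three other variables. Adding [x_i a] to entry [i] then changes every shifted
    entry by the same multiple of [x_0 x_1 x_2 x_3]. *)
Definition shift3 (i : 'I_4) : mon := [multinom (i != j : nat) | j < 4].

Lemma shift0_eqv : shift_equivariant shift0.
Proof. by move=> s i; apply/mnmP => j; rewrite !mnmE. Qed.
Lemma shift1_eqv : shift_equivariant shift1.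
Proof. by move=> s i; apply/mnmP => j; rewrite !mnmE (inj_eq perm_inj). Qed.
Lemma shift3_eqv : shift_equivariant shift3.
Proof. by move=> s i; apply/mnmP => j; rewrite !mnmE (inj_eq perm_inj). Qed.

Lemma shift1_le (m : mon) i : (shift1 i <= m)%MM = (m i != 0%N).
Proof.
apply/mnm_lepP/idP => [/(_ i)|mi j]; rewrite mnmE; first by rewrite eqxx lt0n.
by case: eqP => // <-; rewrite lt0n.
Qed.

Lemma shift3_le (m : mon) i : (shift3 i <= m)%MM = [forall j, (i != j) ==> (m j != 0%N)].
Proof.
apply/mnm_lepP/forallP => h j; have := h j; rewrite mnmE.
  by case: eqP => //= _; rewrite lt0n.
by case: eqP => //= _; rewrite lt0n.
Qed.

Definition block_closed (W : mon -> blk -> Prop) :=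
  [/\ forall m, W m 0, forall m a c d, W m c -> W m d -> W m (a *: c + d)
    & forall (s : 'S_4) m (c d : blk), (forall i, d (s i) = c i) -> W (m#s) c -> W m d].

Lemma sum_lin (a : R) (c d : blk) : \sum_i (a *: c + d) i = a * \sum_i c i + \sum_i d i.
Proof. by rewrite mulr_sumr -big_split; apply: eq_bigr => i _; rewrite !ffunE. Qed.

Lemma sum_perm (s : 'S_4) (c d : blk) : (forall i, d (s i) = c i) -> \sum_i d i = \sum_i c i.
Proof.
by move=> h; rewrite (reindex_inj (@perm_inj _ s)); apply: eq_bigr => i _; rewrite h.
Qed.

Lemma sum_0 : \sum_i (0 : blk) i = 0.
Proof. by rewrite big1 // => i _; rewrite ffunE. Qed.

Lemma blkDZ (a : R) (c d : blk) i : (a *: c + d) i = a * c i + d i.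
Proof. by rewrite !ffunE. Qed.

Lemma W_sum_closed : block_closed (@W_sum R).
Proof.
split=> [m|m a c d c0 d0|s m c d cd c0]; rewrite /W_sum ?sum_0 //.
  by rewrite sum_lin c0 d0 mulr0 addr0.
by rewrite (sum_perm cd).
Qed.

Lemma W_supp_closed : block_closed (@W_supp R).
Proof.
split=> [m|m a c d [c0 cs] [d0 ds]|s m c d cd [c0 cs]].
- by split=> [|i _]; rewrite ?sum_0 // ffunE.
- by split=> [|i mi]; rewrite ?sum_lin ?c0 ?d0 ?blkDZ ?cs ?ds // mulr0 addr0.
- split=> [|i mi]; first by rewrite (sum_perm cd).
  by rewrite -(permKV s i) cd cs // mnmE permKV.
Qed.

Lemma W_full_closed : block_closed W_full.
Proof.
split=> [m|m a c d [c0 cs] [d0 ds]|s m c d cd [c0 cs]].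
- by split=> [|i j _]; rewrite ?sum_0 // ffunE.
- by split=> [|i j mj]; rewrite ?sum_lin ?c0 ?d0 ?blkDZ ?(cs i j) ?(ds i j) // mulr0 addr0.
- split=> [|i j mj]; first by rewrite (sum_perm cd).
  by rewrite -(permKV s i) cd (cs _ (s^-1 j)%g) // mnmE permKV.
Qed.

Lemma W_cofull_closed : block_closed W_cofull.
Proof.
split=> [m|m a c d [c0 cs] [d0 ds]|s m c d cd [c0 cs]].
- by split=> [_|i j _ _]; rewrite ?sum_0 // ffunE.
- split=> [m0|i j ij mj]; first by rewrite sum_lin c0 // d0 // mulr0 addr0.
  by rewrite blkDZ (cs i j) // (ds i j) // mulr0 addr0.
- split=> [m0|i j ij mj]; first by rewrite (sum_perm cd) c0 // => j; rewrite mnmE.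
  by rewrite -(permKV s i) cd (cs _ (s^-1 j)%g) ?(inj_eq perm_inj) // mnmE permKV.
Qed.

Lemma blockspace_lin sg (Q : pred mon) W : block_closed W -> forall a p q,
  blockspace sg Q W p -> blockspace sg Q W q -> blockspace sg Q W (a *: p + q).
Proof.
move=> [_ WD _] a p q Sp Sq m; have := Sp m; have := Sq m.
rewrite blockD blockZ; case: ifP => _; first by move=> *; apply: WD.
by move=> -> ->; rewrite scaler0 addr0.
Qed.

Lemma blockspace_vact sg (Q : pred mon) W : shift_equivariant sg -> perm_inv Q ->
  block_closed W -> forall s p, blockspace sg Q W p -> blockspace sg Q W (vact s p).
Proof.
move=> eqv invQ [_ _ WP] s p Sp m; have := Sp (m#s); rewrite invQ; case: ifP => _ h.
  by apply: WP h => i; rewrite block_vact.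
apply/ffunP => i; rewrite -(permKV s i) block_vact // h.
by rewrite !ffunE.
Qed.

Lemma signed_basis_sum D : signed_basis (blockspace shift0 (of_deg D) (@W_sum R)).
Proof.
apply: (signed_basis_of_local (D := D)) => //.
- exact: shift0_eqv.
- exact: of_deg_perm.
- by move=> m /eqP.
- by move=> m _; case: W_sum_closed.
- by move=> m c _ _ i /negP[]; apply/mnm_lepP => j; rewrite mnmE.
- exact: local_basis_sum.
Qed.

Lemma signed_basis_full sg D : shift_equivariant sg ->
  (forall (m : mon) i, (forall j, m j <> 0%N) -> (sg i <= m)%MM) ->
  signed_basis (blockspace sg (of_deg D) W_full).
Proof.
move=> eqv sgle; apply: (signed_basis_of_local (D := D)) => //.
- exact: of_deg_perm.
- by move=> m /eqP.
- by move=> m _; case: W_full_closed.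
- move=> m c _ [_ cs] i; have [m0|/nzeros_neq0[j mj]] := boolP (nzeros m == 0%N).
    by rewrite sgle //; apply/nzeros_eq0P.
  by rewrite (cs i j).
- exact: local_basis_full.
Qed.

Lemma signed_basis_cofull sg D : shift_equivariant sg ->
  (forall (m : mon) i, (forall j, i != j -> m j <> 0%N) -> (sg i <= m)%MM) ->
  signed_basis (blockspace sg (of_deg D) W_cofull).
Proof.
move=> eqv sgle; apply: (signed_basis_of_local (D := D)) => //.
- exact: of_deg_perm.
- by move=> m /eqP.
- by move=> m _; case: W_cofull_closed.
- move=> m c _ [_ cs] i h.
  case: (pickP (fun j => (i != j) && (m j == 0%N))) => [j /andP[ij /eqP mj]|m0].
    exact: (cs i j).
  by case/negP: h; apply: sgle => j ij mj; have := m0 j; rewrite ij mj.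
- exact: local_basis_cofull.
Qed.

Lemma signed_basis_supp sg D : shift_equivariant sg ->
  (forall (m : mon) i, m i != 0%N -> (sg i <= m)%MM) ->
  signed_basis (blockspace sg (of_deg D) (@W_supp R)) <-> ~ exists q, D = (3 * q + 3)%N.
Proof.
move=> eqv sgle; split=> [sb [q Dq]|nD].
  apply: (@no_signed_basis R sg q.+1) => //.
  by move: sb; rewrite Dq -mulnSr.
apply: (signed_basis_of_local (D := D)) => //.
- exact: of_deg_perm.
- by move=> m /eqP.
- by move=> m _; case: W_supp_closed.
- by move=> m c _ [_ cs] i h; apply: cs; apply/eqP; apply: contraNT h; apply: sgle.
- apply: local_basis_supp => m /eqP mD m1; apply/negP => /dvdnP[q mq].
  case: q mq => [|q] mq; last by apply: nD; exists q; rewrite -mD mq; lia.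
  (* Degree 0 is divisible by 3 but harmless: its only monomial has four zero exponents, not one. *)
  have [l ml] := nzeros_eq1 m1.
  have z : forall i, m i = 0%N.
    move=> i; have : (m i <= mdeg m)%N by rewrite mdegE (bigD1 i) //= leq_addr.
    by rewrite mq leqn0 => /eqP.
  by have := ml (if l == o0 then o1 else o0); rewrite z eqxx; elim/ord4_ind: (l).
Qed.

End SignedBases.

(** * Transfer of invariant bases between forms and polynomial tuples *)

Section Transport.
Variable R : realType.
Variables (k : nat) (V : form R 3 k -> Prop) (S : vec R -> Prop).
Variables (Phi : vec R -> form R 3 k) (par : 'S_4 -> bool).

Hypothesis V_image : forall w,
  V w <-> exists p, S p /\ forall x vs, w x vs = Phi p x vs.
Hypothesis Phi_inj : forall p, S p -> (forall x vs, Phi p x vs = 0) -> p = 0.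
Hypothesis Phi_lin : forall a p q x vs,
  Phi (a *: p + q) x vs = a * Phi p x vs + Phi q x vs.
Hypothesis Phi_act : forall s p x vs,
  Defs.act R 3 s k (Phi p) x vs = (-1) ^+ par s * Phi (vact s p) x vs.
Hypothesis S_lin : forall a p q, S p -> S q -> S (a *: p + q).
Hypothesis S_vact : forall s p, S p -> S (vact s p).
Hypothesis S_0 : S 0.

Lemma Phi0 x vs : Phi 0 x vs = 0.
Proof. by have := Phi_lin 1 0 0 x vs; rewrite scaler0 addr0 mul1r; lra. Qed.

Lemma Phi_sum (J : finType) (P : pred J) (b : J -> R) (xi : J -> vec R) x vs :
  Phi (\sum_(j | P j) b j *: xi j) x vs = \sum_(j | P j) b j * Phi (xi j) x vs.
Proof.
apply: (big_rec2 (fun p a => Phi p x vs = a)); first exact: Phi0.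
by move=> j p a _ <-; rewrite Phi_lin.
Qed.

Lemma S_sum (J : finType) (P : pred J) (b : J -> R) (xi : J -> vec R) :
  (forall j, P j -> S (xi j)) -> S (\sum_(j | P j) b j *: xi j).
Proof.
move=> h; apply: (big_ind (fun p => S p)) => [//|p q Sp Sq|j Pj].
  by rewrite -[p]scale1r; apply: S_lin.
by rewrite -[_ *: _]addr0; apply: S_lin => //; apply: h.
Qed.

Lemma Phi_eq p q : S p -> S q -> (forall x vs, Phi p x vs = Phi q x vs) -> p = q.
Proof.
move=> Sp Sq e; apply/eqP; rewrite -subr_eq0; apply/eqP.
have -> : p - q = (-1) *: q + p by rewrite scaleN1r addrC.
by apply: Phi_inj => [|x vs]; [apply: S_lin|rewrite Phi_lin e; ring].
Qed.

Lemma has_inv_basis_transport : has_inv_basis V <-> signed_basis S.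
Proof.
split.
- move=> [m [xi [[xiV ind gen] sgn]]].
  have [p hp] : exists p : 'I_m -> vec R, forall i,
      S (p i) /\ forall x vs, xi i x vs = Phi (p i) x vs.
    apply: (fin_all_exists (P := fun i q => S q /\ forall x vs, xi i x vs = Phi q x vs)) => i.
    exact: (proj1 (V_image (xi i)) (xiV i)).
  exists 'I_m, xpredT, p; split.
  + by move=> i _; case: (hp i).
  + move=> b b0 i _; apply: ind => x vs.
    transitivity (Phi (\sum_j b j *: p j) x vs); last by rewrite b0 Phi0.
    by rewrite Phi_sum; apply: eq_bigr => l _; case: (hp l) => _ ->.
  + move=> q Sq; have [|c hc] := gen (Phi q); first by apply/V_image; exists q.
    exists c; apply: Phi_eq => //; first by apply: S_sum => i _; case: (hp i).
    move=> x vs; rewrite hc Phi_sum; apply: eq_bigr => l _.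
    by case: (hp l) => _ ->.
  + move=> s i _; have [i' [e he]] := sgn s i.
    (* The two actions differ by the sign [par s], which the freedom of sign in both notions of
       basis absorbs. *)
    exists i', (e (+) par s); split=> //.
    have [Si ei] := hp i; have [Si' ei'] := hp i'.
    apply: Phi_eq; first exact: S_vact.
      by rewrite -[_ *: _]addr0; apply: S_lin.
    move=> x vs; rewrite -[_ *: _]addr0 Phi_lin Phi0 addr0.
    have := he x vs; rewrite {1}/Defs.act ei ei' => h.
    have := Phi_act s (p i) x vs; rewrite {1}/Defs.act h signr_addb => h'.
    rewrite [_ * (-1) ^+ par s]mulrC -mulrA h' mulrA -signr_addb addbb mul1r.
    by [].
- move=> [J [P [xi [xiS ind gen sgn]]]].
  pose ev (i : 'I_#|P|) : J := enum_val i.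
  have Pev i : P (ev i) by have := enum_valP i.
  exists #|P|, (fun i => Phi (xi (ev i))); split; [split|].
  + by move=> i; apply/V_image; exists (xi (ev i)); split=> //; apply: xiS.
  + move=> c c0 i.
    pose b j := \sum_(l | ev l == j) c l.
    have bE l : b (ev l) = c l.
      by rewrite /b (big_pred1 l) // => l'; apply/eqP/eqP => [/enum_val_inj|->].
    rewrite -bE; apply: ind => //; apply: Phi_inj => [|x vs]; first exact: S_sum.
    rewrite Phi_sum -[RHS](c0 x vs).
    rewrite (eq_bigl (mem P)) // big_enum_val.
    by apply: eq_bigr => l _; rewrite bE.
  + move=> w /V_image[q [Sq wq]]; have [b qb] := gen q Sq.
    exists (fun i => b (ev i)) => x vs; rewrite wq qb Phi_sum.
    by rewrite (eq_bigl (mem P)) // big_enum_val.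
  + move=> s i; have [j' [e [Pj' he]]] := sgn s (ev i) (Pev i).
    exists (enum_rank_in Pj' j'), (e (+) par s) => x vs.
    rewrite /ev enum_rankK_in // Phi_act he -[_ *: _]addr0 Phi_lin Phi0 signr_addb.
    ring.
Qed.

End Transport.

(** * Polynomials on the simplex *)

Section PolynomialsOnSimplex.
Variable R : realType.
Local Notation mp := {mpoly R[4]}.
Local Notation inT := (inT R 3).
Local Notation poly_lt := (poly_lt R 3).
Implicit Types (p q : mp) (x : pt R 3).

Lemma meval_homogZ d p (c : R) x : p \is d.-homog ->
  p.@[fun i => c * x i] = c ^+ d * p.@[x].
Proof.
move=> /dhomogP hp; rewrite !mevalE mulr_sumr; apply: eq_big_seq => m ms.
have <- : mdeg m = d := hp m ms.
rewrite mulrCA; congr (_ * _).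
by rewrite mdegE -prodrXr -big_split; apply: eq_bigr => i _; rewrite exprMn.
Qed.

Lemma digit_inj (N a b a' b' : nat) : (a < N)%N -> (a' < N)%N ->
  (a + N * b = a' + N * b')%N -> a = a' /\ b = b'.
Proof.
move=> aN a'N e.
have : ((a + N * b) %% N = (a' + N * b') %% N)%N by rewrite e.
rewrite ![(N * _)%N]mulnC ![(_ + _ * N)%N]addnC !modnMDl !modn_small // => eaa.
split=> //; move: e; rewrite eaa => /addnI/eqP.
by rewrite eqn_mul2l => /orP[/eqP N0|/eqP //]; rewrite N0 in aN.
Qed.

(* Kronecker's substitution x_i = t ^ (N ^ i) sends distinct monomials of
   degree less than N to distinct powers of t. *)
Definition kronecker (N : nat) (m : mon) : nat :=
  (m o0 + N * (m o1 + N * (m o2 + N * m o3)))%N.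

Lemma kronecker_inj d (m m' : mon) : mdeg m = d -> mdeg m' = d ->
  kronecker d.+1 m = kronecker d.+1 m' -> m = m'.
Proof.
have lt (n : mon) i : mdeg n = d -> (n i < d.+1)%N.
  by move=> <-; rewrite ltnS mdegE (bigD1 i) //= leq_addr.
move=> md m'd /(digit_inj (lt _ _ md) (lt _ _ m'd))[e0].
move=> /(digit_inj (lt _ _ md) (lt _ _ m'd))[e1].
move=> /(digit_inj (lt _ _ md) (lt _ _ m'd))[e2 e3].
by apply/mnmP; apply: ord4_ind.
Qed.

Lemma prod_kronecker (N : nat) (m : mon) (t : R) :
  t ^+ kronecker N m = \prod_(i < 4) (t ^+ (N ^ i)) ^+ m i.
Proof.
rewrite big4 /= -!exprM -!exprD /kronecker; congr (_ ^+ _).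
by rewrite expn0 expn1 !expnS expn0; ring.
Qed.

Lemma poly_eq0_pos (P : {poly R}) : (forall t, 0 < t -> P.[t] = 0) -> P = 0.
Proof.
move=> h; pose rs := [seq (k.+1%:R : R) | k <- iota 0 (size P)].
apply: (@roots_geq_poly_eq0 _ P rs); last by rewrite size_map size_iota.
- apply/allP => _ /mapP[k _ ->]; apply/eqP/h; exact: ltr0Sn.
- rewrite map_inj_uniq ?iota_uniq // => a b /eqP; rewrite eqr_nat => /eqP[].
  by [].
Qed.

(** Homogeneity extends the vanishing from the simplex to its cone, where Kronecker's substitution
    turns the monomials free of variables in [J] into distinct powers of one positive variable. *)
Lemma homog_vanish d p (J : pred 'I_4) (i0 : 'I_4) : ~~ J i0 -> p \is d.-homog ->
  (forall x, inT x -> (forall j, J j -> x j = 0) -> p.@[x] = 0) ->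
  forall m : mon, (forall j, J j -> m j = 0%N) -> p@_m = 0.
Proof.
move=> Ji0 hp p0 m Jm.
have hpm n : n \in msupp p -> mdeg n = d by move: n; apply/dhomogP.
have [ms|ms] := boolP (m \in msupp p); last by apply/eqP; rewrite mcoeff_eq0.
pose ok (m : mon) := [forall j, J j ==> (m j == 0%N)].
have okm : ok m by apply/forallP => j; apply/implyP => /Jm/eqP.
pose P : {poly R} := \sum_(m <- msupp p | ok m) p@_m *: 'X^(kronecker d.+1 m).
have P0 : P = 0.
  apply: poly_eq0_pos => t t0.
  (* The index [i0] outside [J] keeps the coordinate sum positive, so this point can be scaled into
     the simplex. *)
  pose x : pt R 3 := fun i => if J i then 0 else t ^+ (d.+1 ^ i).
  have x0 i : 0 <= x i by rewrite /x; case: ifP => // _; rewrite exprn_ge0 // ltW.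
  have s0 : 0 < \sum_i x i.
    rewrite (bigD1 i0) //= ltr_wpDr ?sumr_ge0 //.
    by rewrite /x (negbTE Ji0) exprn_gt0.
  have := p0 (fun i => (\sum_i x i)^-1 * x i).
  have px : p.@[x] = P.[t].
    rewrite mevalE horner_sum [RHS]big_mkcond; apply: eq_bigr => n _.
    rewrite hornerZ hornerXn prod_kronecker; case: ifP => [/forallP okn|/negbT].
      congr (_ * _); apply: eq_bigr => i _; rewrite /x.
      by case: ifP (okn i) => //= _ /eqP ->; rewrite !expr0.
    rewrite negb_forall => /existsP[j]; rewrite negb_imply => /andP[Jj nj].
    by rewrite (bigD1 j) //= /x Jj expr0n (negbTE nj) mul0r mulr0.
  rewrite (meval_homogZ _ _ hp) px => h.
  have /eqP : (\sum_i x i)^-1 ^+ d * P.[t] = 0.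
    apply: h => [|j Jj]; last by rewrite /x Jj mulr0.
    apply/andP; split; last by rewrite -mulr_sumr mulVf ?lt0r_neq0.
    by apply/forallP => i; apply: mulr_ge0; [rewrite invr_ge0; exact: ltW|exact: x0].
  by rewrite mulf_eq0 expf_eq0 invr_eq0 (gt_eqF s0) andbF => /eqP.
have /(congr1 (fun P : {poly R} => P`_(kronecker d.+1 m))) := P0.
rewrite coef0 coef_sum big_mkcond (bigD1_seq m) ?msupp_uniq //= okm coefZ coefXn eqxx mulr1.
rewrite big1_seq ?addr0 // => n /andP[/eqP nm ns]; case: ifP => // _; rewrite coefZ coefXn.
case: eqP => [e|_]; last by rewrite mulr0.
by case: nm; apply: (@kronecker_inj d); rewrite ?hpm.
Qed.

Lemma homog_eq0 d p : p \is d.-homog ->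
  (forall x, inT x -> p.@[x] = 0) -> p = 0.
Proof.
move=> hp h; apply/mpolyP => m; rewrite mcoeff0.
by apply: (@homog_vanish d p pred0 o0) => // x xT _; apply: h.
Qed.

Definition sumX : mp := \sum_(i < 4) 'X_i.

Lemma sumX_homog : sumX \is 1.-homog.
Proof. by apply: rpred_sum => i _; rewrite dhomogX; apply/eqP; exact: mdeg1. Qed.

Lemma sumX_meval x : inT x -> sumX.@[x] = 1.
Proof.
case/andP=> _ /eqP <-; rewrite raddf_sum; apply: eq_bigr => i _; exact: mevalXU.
Qed.

Lemma sumX_neq0 : sumX != 0.
Proof.
apply/eqP => /(congr1 (fun p : mp => p@_U_(o0)%MM)); rewrite mcoeff0 raddf_sum /=.
rewrite (bigD1 o0) //= mcoeffXU eqxx big1 ?addr0 => [/eqP|i i0]; first by rewrite oner_eq0.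
by rewrite mcoeffXU (negbTE i0).
Qed.

(** Each monomial is multiplied by the missing power of the coordinate sum, which is 1 on the
    simplex. *)
Lemma homogenize d f : poly_lt d.+1 f ->
  exists p, p \is d.-homog /\ forall x, inT x -> f x = p.@[x].
Proof.
move=> [c hc].
pose mn (a : {ffun 'I_4 -> 'I_d.+1}) : mon := [multinom (a i : nat) | i < 4].
exists (\sum_(a : {ffun 'I_4 -> 'I_d.+1} | (\sum_i (a i : nat) < d.+1)%N)
  c a *: ('X_[mn a] * sumX ^+ (d - mdeg (mn a)))); split.
  apply: rpred_sum => a lt; apply: rpredZ.
  have e : (mdeg (mn a) + 1 * (d - mdeg (mn a)))%N = d.
    rewrite mul1n subnKC // -ltnS mdegE (leq_ltn_trans _ lt) //.
    by apply: leq_sum => i _; rewrite mnmE.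
  have h : 'X_[mn a] * sumX ^+ (d - mdeg (mn a)) \is
      (mdeg (mn a) + 1 * (d - mdeg (mn a))).-homog.
    by apply: dhomogM; [rewrite dhomogX|apply/dhomogMn/sumX_homog].
  by rewrite e in h.
move=> x xT; rewrite hc raddf_sum; apply: eq_bigr => a _.
rewrite /= mevalZ mevalM rmorphXn /= sumX_meval // expr1n mulr1 mevalX.
by congr (_ * _); apply: eq_bigr => i _; rewrite mnmE.
Qed.

Lemma poly_lt0 f : poly_lt 0 f -> forall x, f x = 0.
Proof. by move=> [c hc] x; rewrite hc big1 // => a; rewrite ltn0. Qed.

Lemma poly_ltD d f g : poly_lt d f -> poly_lt d g -> poly_lt d (fun x => f x + g x).
Proof.
move=> [a ha] [b hb]; exists (fun k => a k + b k) => x.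
by rewrite ha hb -big_split; apply: eq_bigr => k _; rewrite mulrDl.
Qed.

Lemma poly_lt_ext d f g : (forall x, f x = g x) -> poly_lt d f -> poly_lt d g.
Proof. by move=> e [c hc]; exists c => x; rewrite -e. Qed.

Lemma poly_lt_zero d : poly_lt d (fun=> 0).
Proof. by exists (fun=> 0) => x; rewrite big1 // => a _; rewrite mul0r. Qed.

Lemma poly_lt_monomial d c (m : mon) : (mdeg m < d)%N ->
  poly_lt d (fun x => c * \prod_i x i ^+ m i).
Proof.
case: d => // d lt.
pose a : {ffun 'I_4 -> 'I_d.+1} := [ffun i => inord (m i)].
have ai i : (a i : nat) = m i.
  rewrite ffunE inordK // (leq_ltn_trans _ lt) // mdegE (bigD1 i) //=.
  exact: leq_addr.
exists (fun b => if b == a then c else 0) => x.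
rewrite (bigD1 a) /=; last by rewrite (eq_bigr _ (fun i _ => ai i)) -mdegE.
rewrite eqxx [X in _ + X]big1 ?addr0; last first.
  by move=> b /andP[_ /negbTE ->]; rewrite mul0r.
by congr (_ * _); apply: eq_bigr => i _; rewrite ai.
Qed.

Lemma poly_lt_meval d p : (forall m, m \in msupp p -> (mdeg m < d)%N) ->
  poly_lt d (fun x => p.@[x]).
Proof.
move=> h; apply: (poly_lt_ext (f := fun x => \sum_(m <- msupp p) p@_m * \prod_i x i ^+ m i)).
  by move=> x; rewrite mevalE.
elim: (msupp p) h => [|m s IH] h.
  by apply: poly_lt_ext (poly_lt_zero d) => x; rewrite big_nil.
have := poly_ltD (poly_lt_monomial p@_m (h m _)) (IH _); rewrite mem_head => /(_ isT) h'.
apply: poly_lt_ext (h' _) => [x|n ns]; first by rewrite big_cons.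
by apply: h; rewrite inE ns orbT.
Qed.

End PolynomialsOnSimplex.

(** * Forms on the tetrahedron *)

Section FormSpaces.
Variable R : realType.
Local Notation mp := {mpoly R[4]}.
Local Notation vec := (vec R).
Local Notation inT := (inT R 3).
Local Notation tangent := (tangent R 3).
Local Notation poly_lt := (poly_lt R 3).
Local Notation inP_lt := (inP_lt R 3).
Local Notation dlam := (dlam R 3).
Local Notation pt := (pt R 3).
Implicit Types (p q : mp) (x : pt).

(* Homogeneous of degree [d - 1], hence zero when [d = 0]: this matches
   [poly_lt] and covers the spaces of negative degree. *)
Definition homog_pred (d : nat) (p : mp) : Prop := forall m, p@_m != 0 -> (mdeg m).+1 = d.

Lemma homog_pred_homog d p : homog_pred d.+1 p <-> p \is d.-homog.
Proof.
split=> h; last by move=> m; rewrite -mcoeff_msupp => ms; congr S; move: m ms; apply/dhomogP.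
by apply/dhomogP => m; rewrite mcoeff_msupp => /h[].
Qed.

Lemma homog_pred0 p : homog_pred 0 p -> p = 0.
Proof.
by move=> h; apply/mpolyP => m; rewrite mcoeff0; case: (eqVneq p@_m 0) => // /h.
Qed.

Lemma homog_pred_zero d : homog_pred d 0.
Proof. by move=> m; rewrite mcoeff0 eqxx. Qed.

Lemma homog_pred_lin d a p q : homog_pred d p -> homog_pred d q -> homog_pred d (a *: p + q).
Proof.
move=> hp hq m; rewrite mcoeffD mcoeffZ; have [->|/hp//] := eqVneq p@_m 0.
by rewrite mulr0 add0r; apply: hq.
Qed.

Lemma homog_pred_sum d (I : finType) (F : I -> mp) :
  (forall i, homog_pred d (F i)) -> homog_pred d (\sum_i F i).
Proof.
move=> h; apply: (big_ind (homog_pred d)) => //; first exact: homog_pred_zero.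
by move=> a b ha hb; rewrite -[a]scale1r; apply: homog_pred_lin.
Qed.

Lemma homog_predM d e p q : homog_pred d p -> q \is e.-homog -> homog_pred (d + e) (p * q).
Proof.
case: d => [/homog_pred0 ->|d /homog_pred_homog hp hq]; first by rewrite mul0r => _; apply: homog_pred_zero.
by apply/homog_pred_homog/dhomogM.
Qed.

Lemma homog_pred_vanish d p (J : pred 'I_4) (i0 : 'I_4) : ~~ J i0 -> homog_pred d p ->
  (forall x, inT x -> (forall j, J j -> x j = 0) -> p.@[x] = 0) ->
  forall m : mon, (forall j, J j -> m j = 0%N) -> p@_m = 0.
Proof.
case: d => [_ /homog_pred0 -> _ m _|d Ji0 /homog_pred_homog]; first exact: mcoeff0.
move=> hp h m Jm; exact: (homog_vanish Ji0 hp h).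
Qed.

Lemma homog_pred_eq0 d p : homog_pred d p -> (forall x, inT x -> p.@[x] = 0) -> p = 0.
Proof. by case: d => [/homog_pred0//|d /homog_pred_homog]; apply: homog_eq0. Qed.

Lemma homog_pred_of_poly_lt d f : poly_lt d f ->
  exists p, homog_pred d p /\ forall x, inT x -> f x = p.@[x].
Proof.
case: d => [h|d /homogenize[p [hp e]]]; last by exists p; split=> //; apply/homog_pred_homog.
by exists 0; split=> [|x _]; [apply: homog_pred_zero|rewrite meval0 (poly_lt0 h)].
Qed.

Lemma poly_lt_homog_pred d p : homog_pred d p -> poly_lt d (fun x => p.@[x]).
Proof. by move=> h; apply: poly_lt_meval => m; rewrite mcoeff_msupp => /h <-. Qed.

Lemma mcoeff_XM (k m : mon) p :
  ('X_[k] * p)@_m = if (k <= m)%MM then p@_(m - k)%MM else 0.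
Proof.
case: ifPn => [km|km]; first by have := mcoeffMX p k (m - k)%MM; rewrite addmC submK // mulrC.
rewrite {1}[p]mpolyE mulr_sumr raddf_sum big1 // => n _ /=.
rewrite -scalerAr -mpolyXD mcoeffZ mcoeffX; case: eqP => [e|_]; last by rewrite mulr0.
by case/negP: km; rewrite -e; apply/mnm_lepP => i; rewrite mnmDE leq_addr.
Qed.

Lemma euler d p : homog_pred d.+1 p -> \sum_(i < 4) 'X_i * p^`M(i) = d%:R *: p.
Proof.
move=> hp; apply/mpolyP => m; rewrite raddf_sum mcoeffZ /=.
have [p0|p0] := eqVneq p@_m 0.
  rewrite p0 mulr0 big1 // => i _; rewrite mcoeff_XM; case: ifP => // le.
  by rewrite mcoeff_deriv submK // p0 mul0rn.
have [<-] := hp m p0; rewrite mdegE natr_sum mulr_suml; apply: eq_bigr => i _.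
rewrite mcoeff_XM; case: ifPn => le.
  rewrite mcoeff_deriv submK // mulr_natl mnmBE mnm1E eqxx -subSn ?subn1 //.
  by move/mnm_lepP: le => /(_ i); rewrite mnm1E eqxx.
have -> : m i = 0%N; last by rewrite mul0r.
apply/eqP; apply: contraNT le => mi; apply/mnm_lepP => j; rewrite mnm1E.
by case: eqP => // <-; rewrite lt0n.
Qed.

Lemma homog_pred_deriv d p i : homog_pred d.+1 p -> homog_pred d (p^`M(i)).
Proof.
move=> hp m; rewrite mcoeff_deriv => h.
have /hp : p@_(m + U_(i)) != 0 by apply: contraNneq h => ->; rewrite mul0rn.
by rewrite mdegD mdeg1 addn1 => -[].
Qed.

Lemma dlam1E (f : 'I_1 -> 'I_4) vs : dlam 1 f vs = vs ord0 (f ord0).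
Proof. by rewrite /Defs.dlam det_mx11 mxE. Qed.

Lemma dlam2E (f : 'I_2 -> 'I_4) vs : dlam 2 f vs =
  vs ord0 (f ord0) * vs ord_max (f ord_max) - vs ord_max (f ord0) * vs ord0 (f ord_max).
Proof. by rewrite /Defs.dlam det_mx22 !mxE. Qed.

Lemma dlam_ext k (f g : 'I_k -> 'I_4) vs : f =1 g -> dlam k f vs = dlam k g vs.
Proof. by move=> e; congr (\det _); apply/matrixP => a b; rewrite !mxE e. Qed.

Lemma inP_lt_ext d k (w w' : form R 3 k) : (forall x vs, w x vs = w' x vs) ->
  inP_lt d k w -> inP_lt d k w'.
Proof. by move=> e [p [hp hw]]; exists p; split=> // x vs; rewrite -e. Qed.

Lemma inP_ltD d k (w w' : form R 3 k) : inP_lt d k w -> inP_lt d k w' ->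
  inP_lt d k (fun x vs => w x vs + w' x vs).
Proof.
move=> [p [hp hw]] [p' [hp' hw']]; exists (fun f x => p f x + p' f x); split.
  by move=> f; apply: poly_ltD.
by move=> x vs; rewrite hw hw' -big_split; apply: eq_bigr => f _; rewrite mulrDl.
Qed.

Lemma inP_lt_term d k (p : mp) (f : 'I_k -> 'I_4) : homog_pred d p ->
  inP_lt d k (fun x vs => p.@[x] * dlam k f vs).
Proof.
move=> hp; exists (fun g x => if g == finfun f then p.@[x] else 0); split.
  by move=> g; case: (g == _); [apply: poly_lt_homog_pred|apply: poly_lt_zero].
move=> x vs; rewrite (bigD1 (finfun f)) //= eqxx [X in _ + X]big1 ?addr0; last first.
  by move=> g /negbTE ->; rewrite mul0r.
by congr (_ * _); apply: dlam_ext => a; rewrite ffunE.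
Qed.

Lemma inP_lt_sum d k (I : finType) (F : I -> form R 3 k) : (forall i, inP_lt d k (F i)) ->
  inP_lt d k (fun x vs => \sum_i F i x vs).
Proof.
move=> h; elim: (index_enum I) => [|i s IH].
  exists (fun _ _ => 0); split=> [f|x vs]; first exact: poly_lt_zero.
  by rewrite big_nil big1 // => f _; rewrite mul0r.
by apply: inP_lt_ext (inP_ltD (h i) IH) => x vs; rewrite big_cons.
Qed.

(* [l] holds the values of a basic family of forms and [a f] the coordinates of
   d lambda_f in it: this rewrites a form with homogenized coefficients. *)
Lemma inP_lt_coords d e k (eta : form R 3 k) (l : pt -> ('I_k -> pt) -> 'I_4 -> R)
    (a : {ffun 'I_k -> 'I_4} -> 'I_4 -> mp) (dom : pt -> ('I_k -> pt) -> Prop) :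
    inP_lt d k eta -> (forall x vs, dom x vs -> inT x) ->
    (forall f i, a f i \is e.-homog) ->
    (forall (f : {ffun 'I_k -> 'I_4}) x vs, dom x vs -> dlam k f vs = \sum_i l x vs i * (a f i).@[x]) ->
  exists h : {ffun 'I_k -> 'I_4} -> mp,
    let q i := \sum_f h f * a f i in
    (forall i, homog_pred (d + e) (q i)) /\
    forall x vs, dom x vs -> eta x vs = \sum_i l x vs i * (q i).@[x].
Proof.
move=> [p [hp ep]] domT ha hl.
have [h hh] : exists h : {ffun 'I_k -> 'I_4} -> mp, forall f, homog_pred d (h f) /\
    forall x, inT x -> p f x = (h f).@[x].
  apply: (fin_all_exists (P := fun f q => homog_pred d q /\ forall x, inT x -> p f x = q.@[x])) => f.
  exact: homog_pred_of_poly_lt.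
exists h; split=> [i|x vs xvs].
  by apply: homog_pred_sum => f; apply: homog_predM => //; case: (hh f).
rewrite ep; transitivity (\sum_f \sum_i l x vs i * ((h f).@[x] * (a f i).@[x])).
  apply: eq_bigr => f _; rewrite (proj2 (hh f)) ?(domT _ vs) // (hl f x) // mulr_sumr.
  by apply: eq_bigr => i _; rewrite mulrCA.
rewrite exchange_big; apply: eq_bigr => i _; rewrite -mulr_sumr; congr (_ * _).
by rewrite raddf_sum; apply: eq_bigr => f _; rewrite /= mevalM.
Qed.

Definition on_simplex k (x : pt) (vs : 'I_k -> pt) : bool := inT x && [forall b, tangent (vs b)].

Lemma restr_eq k (w w' : form R 3 k) :
  (forall x vs, on_simplex x vs -> w x vs = w' x vs) ->
  forall x vs, restr R 3 k w x vs = restr R 3 k w' x vs.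
Proof. by move=> h x vs; rewrite /restr; case: ifP => // /h. Qed.

Definition Phi1 (p : vec) : form R 3 1 := restr R 3 1 (fun x vs =>
  \sum_i vs ord0 i * (p i).@[x]).

Definition Phi2 (u : vec) : form R 3 2 := restr R 3 2 (fun x vs =>
  det4 x (fun i => (u i).@[x]) (vs ord0) (vs ord_max)).

Definition unit_pt (i : 'I_4) : pt := fun j => (i == j)%:R.

Lemma det4_coords x (u v w : pt) :
  det4 x u v w = \sum_i det4 x (unit_pt i) v w * u i.
Proof. by rewrite big4 /= !det4E /unit_pt /=; ring. Qed.

Lemma homogC (c : R) : c%:MP \is [in R[4], 0.-homog].
Proof. by rewrite -[c%:MP]mulr1 mul_mpolyC; apply: dhomogZ; apply: dhomog1. Qed.

Lemma PT1_coords r w : PT r 1 w <-> exists p : vec, (forall i, homog_pred r.+1 (p i)) /\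
  forall x vs, w x vs = Phi1 p x vs.
Proof.
split=> [[w' [hw' ew]]|[p [hp ew]]].
  have [|||h [hq eq]] := @inP_lt_coords _ 0 _ _ (fun x vs i => vs ord0 i)
    (fun f i => (f ord0 == i)%:R%:MP) (fun x vs => inT x) hw'.
  - by [].
  - by move=> f i; apply: homogC.
  - move=> f x vs _; rewrite dlam1E (bigD1 (f ord0)) //= eqxx mevalC mulr1 big1 ?addr0 // => i.
    by rewrite eq_sym => /negbTE ->; rewrite mevalC mulr0.
  exists [ffun i => \sum_f h f * (f ord0 == i)%:R%:MP]; split=> [i|x vs].
    by rewrite ffunE -[r.+1]addn0.
  rewrite ew; apply: restr_eq => y us /andP[yT _]; rewrite eq //.
  by apply: eq_bigr => i _; rewrite ffunE.
exists (fun x vs => \sum_i (p i).@[x] * dlam 1 (fun=> i) vs); split.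
  by apply: inP_lt_sum => i; apply: inP_lt_term.
move=> x vs; rewrite ew; apply: restr_eq => y us _.
by apply: eq_bigr => i _; rewrite dlam1E mulrC.
Qed.

(** Contraction with the position field squares to zero, which gives the relation. Conversely, a
    form [w] with this relation satisfies [i_X dw = (r + 1) w] by Cartan's formula, since its
    coefficients are homogeneous of degree [r]. *)
Lemma Pminus1_coords r w : PminusT r 1 w <-> exists p : vec, [/\ forall i, homog_pred r.+1 (p i),
  \sum_i 'X_i * p i = 0 & forall x vs, w x vs = Phi1 p x vs].
Proof.
split=> [[w' [[eta [heta eta_w]] ew]]|[p [hp p0 ew]]].
  pose a (f : {ffun 'I_2 -> 'I_4}) (i : 'I_4) : mp :=
    (f ord_max == i)%:R *: 'X_(f ord0) - (f ord0 == i)%:R *: 'X_(f ord_max).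
  have [|||h [hq eq]] := @inP_lt_coords _ 1 _ _ (fun x vs i => vs ord_max i) a
     (fun x vs => inT x /\ vs ord0 = x) heta.
  - by move=> x vs [].
  - by move=> f i; apply: rpredB; apply: rpredZ; rewrite dhomogX; apply/eqP; exact: mdeg1.
  - move=> f x vs [_ xv]; rewrite dlam2E xv /a.
    under eq_bigr do rewrite mevalB !mevalZ !mevalXU mulrBr.
    rewrite sumrB; congr (_ - _).
      rewrite (bigD1 (f ord_max)) //= eqxx big1 ?addr0 ?mul1r 1?mulrC // => i.
      by rewrite eq_sym => /negbTE ->; rewrite mul0r mulr0.
    rewrite (bigD1 (f ord0)) //= eqxx big1 ?addr0 ?mul1r // => i.
    by rewrite eq_sym => /negbTE ->; rewrite mul0r mulr0.
  exists [ffun i => \sum_f h f * a f i]; split=> [i||x vs].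
  - by rewrite ffunE -[r.+1]addn1.
  - under eq_bigr do rewrite ffunE mulr_sumr.
    rewrite exchange_big big1 //= => f _.
    under eq_bigr do rewrite mulrCA.
    rewrite -mulr_sumr /a; under eq_bigr do rewrite mulrBr -!scalerAr.
    rewrite sumrB (bigD1 (f ord_max)) //= (bigD1 (f ord0) (P := predT)) //= !eqxx !scale1r.
    rewrite !big1 => [|i|i]; rewrite 1?eq_sym; try by move=> /negbTE ->; rewrite scale0r.
    by rewrite !addr0 [X in _ - X]mulrC subrr mulr0.
  - rewrite ew; apply: restr_eq => y us /andP[yT _]; rewrite eta_w /contrX eq.
      apply: eq_bigr => i _; rewrite ffunE; congr (_ * _).
      by rewrite /consv (_ : ord_max = lift ord0 ord0) ?liftK //; apply: val_inj.
    by split=> //; rewrite /consv unlift_none.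
(* The coefficients of [dw / (r + 1)], indexed by all ordered pairs. *)
pose P (ab : 'I_4 * 'I_4) : mp := r.+1%:R^-1 *: (p ab.2)^`M(ab.1).
pose fab (ab : 'I_4 * 'I_4) : 'I_2 -> 'I_4 := fun t => if t == ord0 then ab.1 else ab.2.
pose eta : form R 3 2 := fun x vs => \sum_ab (P ab).@[x] * dlam 2 (fab ab) vs.
exists (contrX R 3 1 eta); split.
  exists eta; split=> //; apply: inP_lt_sum => ab; apply: inP_lt_term.
  by rewrite /P -[_ *: _]addr0; apply: homog_pred_lin (homog_pred_zero _); apply: homog_pred_deriv.
move=> x vs; rewrite ew; apply: restr_eq => y us _.
rewrite /contrX /eta.
pose v := us ord0.
transitivity (\sum_a \sum_b r.+1%:R^-1 * ((p b)^`M(a)).@[y] * (y a * v b - v a * y b)); last first.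
  rewrite pair_bigA; apply: eq_bigr => -[a b] _; rewrite /P /= mevalZ dlam2E /consv /fab /=.
  by rewrite unlift_none (_ : ord_max = lift ord0 ord0) ?liftK //; apply: val_inj.
have eu b : \sum_a y a * ((p b)^`M(a)).@[y] = r%:R * (p b).@[y].
  rewrite -mevalZ -(euler (hp b)) raddf_sum; apply: eq_bigr => a _.
  by rewrite /= mevalM mevalXU.
(* Differentiating [sum_b x_b p_b = 0] in direction [a]. Euler's identity contributes [r] and this
   one the remaining 1 of the factor [r + 1]. *)
have ek a : \sum_b y b * ((p b)^`M(a)).@[y] = - (p a).@[y].
  have := congr1 (fun q : mp => (q^`M(a)).@[y]) p0.
  rewrite /= mderiv0 meval0 (big_morph _ (mderivD a) (mderiv0 _ a)) /=.
  rewrite (big_morph _ (mevalD y) (meval0 y)) /=.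
  under eq_bigr do rewrite mderivM mderivX mevalD !mevalM mevalXU mevalZ mnm1E.
  rewrite big_split /= (bigD1 a) //= eqxx mul1r big1 ?addr0.
    rewrite (_ : (U_(a) - U_(a))%MM = 0%MM); last by apply/mnmP => i; rewrite mnmBE subnn mnm0E.
    by rewrite mpolyX0 meval1 mul1r => /eqP; rewrite addrC addr_eq0 => /eqP.
  by move=> i ia; rewrite (negbTE ia) mul0r mul0r.
have -> : \sum_i v i * (p i).@[y] = r.+1%:R^-1 * (\sum_b v b * (r%:R * (p b).@[y]) -
    \sum_a v a * (- (p a).@[y])).
  rewrite -sumrB mulr_sumr; apply: eq_bigr => i _.
  have r0 : r.+1%:R != 0 :> R by rewrite pnatr_eq0.
  by apply: (mulfI r0); rewrite [RHS]mulrA mulfV // mul1r -natr1; ring.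
have -> : \sum_b v b * (r%:R * (p b).@[y]) =
    \sum_a \sum_b v b * (y a * ((p b)^`M(a)).@[y]).
  by rewrite exchange_big; apply: eq_bigr => b _; rewrite -eu mulr_sumr.
have -> : \sum_a v a * (- (p a).@[y]) = \sum_a \sum_b v a * (y b * ((p b)^`M(a)).@[y]).
  by apply: eq_bigr => a _; rewrite -ek mulr_sumr.
rewrite -sumrB mulr_sumr; apply: eq_bigr => a _.
rewrite -sumrB mulr_sumr; apply: eq_bigr => b _; ring.
Qed.

End FormSpaces.

(** * Coordinate forms as determinants *)

Section CoordinateIdentities.
Variable R : realType.
Local Notation dlam := (dlam R 3).
Local Notation pt := (pt R 3).
Local Notation e_ := (@unit_pt R).

Lemma sum4_solve (x : pt) c : \sum_i x i = c -> x o0 = c - x o1 - x o2 - x o3.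
Proof. by rewrite big4 /= => <-; ring. Qed.

(** In the tangent 3-space a 2-form is given by a vector. Here its coordinates are
    [det4 (e_ b) (e_ a) (e_ i) 1], and they sum to zero over [i] because the row of ones is then
    repeated. *)
Lemma two_form_coords (x v w : pt) a b :
  \sum_i x i = 1 -> \sum_i v i = 0 -> \sum_i w i = 0 ->
  v a * w b - w a * v b =
  \sum_i det4 x (e_ i) v w * det4 (e_ b) (e_ a) (e_ i) (fun=> 1).
Proof.
move=> /sum4_solve x0 /sum4_solve v0 /sum4_solve w0.
rewrite big4 /= !det4E /unit_pt /= x0 v0 w0.
by elim/ord4_ind: a; elim/ord4_ind: b; rewrite /= ?v0 ?w0; ring.
Qed.

(** Replacing coordinate 0 by the sum of all coordinates leaves a single 1, in the row of [x]; what
    remains is a 3 by 3 determinant in [u], [v], [w]. *)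
Lemma det4_tangent (x u v w : pt) :
  \sum_i x i = 1 -> \sum_i u i = 0 -> \sum_i v i = 0 -> \sum_i w i = 0 ->
  det4 x u v w = u o1 * (v o2 * w o3 - w o2 * v o3)
    - u o2 * (v o1 * w o3 - w o1 * v o3) + u o3 * (v o1 * w o2 - w o1 * v o2).
Proof.
move=> /sum4_solve x0 /sum4_solve u0 /sum4_solve v0 /sum4_solve w0.
by rewrite det4E /= x0 u0 v0 w0; ring.
Qed.

Lemma dlam3E (f : 'I_3 -> 'I_4) vs :
  let a := f ord0 in let b := f (lift ord0 ord0) in let c := f ord_max in
  let x := vs ord0 in let v := vs (lift ord0 ord0) in let w := vs ord_max in
  dlam 3 f vs = x a * (v b * w c - w b * v c) - v a * (x b * w c - w b * x c)
    + w a * (x b * v c - v b * x c).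
Proof. by rewrite /= /Defs.dlam det_mx33 /= !mxE; ring. Qed.

(** In four dimensions a 3-form is the contraction of the volume form with a vector; the second
    determinants are the coordinates of that vector. *)
Lemma three_form_coords (x v w : pt) a b c :
  x a * (v b * w c - w b * v c) - v a * (x b * w c - w b * x c)
    + w a * (x b * v c - v b * x c) =
  \sum_i det4 x (e_ i) v w * det4 (e_ a) (e_ i) (e_ b) (e_ c).
Proof.
rewrite big4 /= !det4E /unit_pt /=.
by elim/ord4_ind: a; elim/ord4_ind: b; elim/ord4_ind: c; rewrite /=; ring.
Qed.

End CoordinateIdentities.

(** * Coefficient tuples of 2-forms *)

Section TwoForms.
Variable R : realType.
Local Notation mp := {mpoly R[4]}.
Local Notation vec := (vec R).
Local Notation inT := (inT R 3).
Local Notation dlam := (dlam R 3).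
Local Notation pt := (pt R 3).
Local Notation e_ := (@unit_pt R).

Lemma on_simplexE k (x : pt) (vs : 'I_k -> pt) : on_simplex x vs ->
  \sum_i x i = 1 /\ forall b, \sum_i vs b i = 0.
Proof.
case/andP=> /andP[_ /eqP x1] /forallP h; split=> // b; exact/eqP/h.
Qed.

Lemma PT2_coords r w : PT r 2 w <-> exists u : vec, [/\ forall i, homog_pred r.+1 (u i),
  \sum_i u i = 0 & forall x vs, w x vs = Phi2 u x vs].
Proof.
split=> [[w' [hw' ew]]|[u [hu u0 ew]]].
  pose a (f : {ffun 'I_2 -> 'I_4}) (i : 'I_4) : mp :=
    (det4 (e_ (f ord_max)) (e_ (f ord0)) (e_ i) (fun=> 1))%:MP.
  have [|||h [hq eq]] := @inP_lt_coords _ _ 0 _ _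
    (fun x vs i => det4 x (e_ i) (vs ord0) (vs ord_max)) a (fun x vs => on_simplex x vs) hw'.
  - by move=> x vs /andP[].
  - by move=> f i; apply: homogC.
  - move=> f x vs /on_simplexE[x1 vs0]; rewrite dlam2E (two_form_coords _ _ x1) //.
    by apply: eq_bigr => i _; rewrite mevalC.
  exists [ffun i => \sum_f h f * a f i]; split=> [i||x vs].
  - by rewrite ffunE -[r.+1]addn0.
  - under eq_bigr do rewrite ffunE.
    rewrite exchange_big big1 //= => f _; rewrite -mulr_sumr /a.
    rewrite big4 /= -!mpolyCD (_ : _ + _ = 0) ?mpolyC0 ?mulr0 //.
    by rewrite !det4E /unit_pt /=; ring.
  - rewrite ew; apply: restr_eq => y us yus; rewrite eq // [RHS]det4_coords.
    by apply: eq_bigr => i _; rewrite ffunE.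
pose pr (i j : 'I_4) : 'I_2 -> 'I_4 := fun t => if t == ord0 then i else j.
exists (fun x vs => (u o1).@[x] * dlam 2 (pr o2 o3) vs + ((- u o2).@[x] * dlam 2 (pr o1 o3) vs
   + (u o3).@[x] * dlam 2 (pr o1 o2) vs)); split.
  apply: inP_ltD; first exact: inP_lt_term.
  apply: inP_ltD; apply: inP_lt_term => //.
  rewrite -scaleN1r -[_ *: _]addr0; apply: homog_pred_lin => //; exact: homog_pred_zero.
move=> x vs; rewrite ew; apply: restr_eq => y us /on_simplexE[y1 us0].
rewrite det4_tangent //.
  by rewrite !dlam2E /pr /= mevalN; ring.
by rewrite -(big_morph _ (mevalD y) (meval0 y)) u0 meval0.
Qed.

(** Contracting a 3-form with the position field gives [det4 x u v w] with [u] arbitrary, so no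
    relation appears. The price is that [u] is determined only up to multiples of [x]. *)
Lemma Pminus2_coords r w : PminusT r 2 w <-> exists u : vec, (forall i, homog_pred r (u i)) /\
  forall x vs, w x vs = Phi2 u x vs.
Proof.
have cv x (vs : 'I_2 -> pt) :
    [/\ consv R 3 2 x vs ord0 = x, consv R 3 2 x vs (lift ord0 ord0) = vs ord0
      & consv R 3 2 x vs ord_max = vs ord_max].
  rewrite /consv unlift_none liftK (_ : ord_max = lift ord0 ord_max) ?liftK //.
  exact: val_inj.
split=> [[w' [[eta [heta eta_w]] ew]]|[u [hu ew]]].
  pose a (f : {ffun 'I_3 -> 'I_4}) (i : 'I_4) : mp :=
    (det4 (e_ (f ord0)) (e_ i) (e_ (f (lift ord0 ord0))) (e_ (f ord_max)))%:MP.
  have [|||h [hq eq]] := @inP_lt_coords _ _ 0 _ _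
    (fun x vs i => det4 (vs ord0) (e_ i) (vs (lift ord0 ord0)) (vs ord_max)) a
    (fun x vs => inT x) heta.
  - by [].
  - by move=> f i; apply: homogC.
  - move=> f x vs _; rewrite dlam3E /= three_form_coords.
    by apply: eq_bigr => i _; rewrite mevalC.
  exists [ffun i => \sum_f h f * a f i]; split=> [i|x vs].
    by rewrite ffunE -[r]addn0.
  rewrite ew; apply: restr_eq => y us /andP[yT _]; rewrite eta_w /contrX eq // [RHS]det4_coords.
  have [-> -> ->] := cv y us.
  by apply: eq_bigr => i _; rewrite ffunE.
pose tr (i j k : 'I_4) : 'I_3 -> 'I_4 := fun t => tnth [tuple i; j; k] t.
(* Cofactor expansion of the determinant along the row of [u]. *)
pose eta : form R 3 3 := fun x vs => (- u o0).@[x] * dlam 3 (tr o1 o2 o3) vs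
  + ((u o1).@[x] * dlam 3 (tr o0 o2 o3) vs
  + ((- u o2).@[x] * dlam 3 (tr o0 o1 o3) vs + (u o3).@[x] * dlam 3 (tr o0 o1 o2) vs)).
exists (contrX R 3 2 eta); split.
  have hN i : homog_pred r (- u i).
    by rewrite -scaleN1r -[_ *: _]addr0; apply: homog_pred_lin => //; apply: homog_pred_zero.
  exists eta; split=> //; rewrite /eta.
  apply: inP_ltD; first exact: inP_lt_term.
  apply: inP_ltD; first exact: inP_lt_term.
  apply: inP_ltD; first exact: inP_lt_term.
  by apply: inP_lt_term.
move=> x vs; rewrite ew; apply: restr_eq => y us _.
rewrite /contrX /eta !dlam3E /=; have [-> -> ->] := cv y us.
by rewrite /tr !(tnth_nth o0) /= /bump /= !mevalN det4E /=; ring.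
Qed.

End TwoForms.

(** * Equivariance, kernels and traces *)

Section Identification.
Variable R : realType.
Local Notation mp := {mpoly R[4]}.
Local Notation vec := (vec R).
Local Notation inT := (inT R 3).
Local Notation tangent := (tangent R 3).
Local Notation pt := (pt R 3).
Local Notation e_ := (@unit_pt R).
Local Notation trace_free := (trace_free R 3).
Implicit Types (p u : vec) (x v w : pt).

Lemma meval_msym (s : 'S_4) (q : mp) x : (msym s q).@[x] = q.@[fun i => x (s i)].
Proof.
rewrite {1}[q]mpolyE (big_morph _ (msymD s) (msym0 _ s)) (big_morph _ (mevalD x) (meval0 x)).
rewrite mevalE; apply: eq_bigr => m _; rewrite msymZ mevalZ msymX mevalX; congr (_ * _).
by rewrite (reindex_inj (@perm_inj _ s)); apply: eq_bigr => i _; rewrite mnmE permK.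
Qed.

Lemma inT_perm (s : 'S_4) x : inT (fun i => x (s i)) = inT x.
Proof.
rewrite /Defs.inT -(reindex_inj (@perm_inj _ s) (F := x) (P := predT)); congr (_ && _).
apply/forallP/forallP => h i; last exact: h.
by have := h (s^-1 i)%g; rewrite permKV.
Qed.

Lemma tangent_perm (s : 'S_4) v : tangent (fun i => v (s i)) = tangent v.
Proof. by rewrite /Defs.tangent -(reindex_inj (@perm_inj _ s) (F := v) (P := predT)). Qed.

Lemma on_simplex_perm k (s : 'S_4) x (vs : 'I_k -> pt) :
  on_simplex (fun i => x (s i)) (fun b i => vs b (s i)) = on_simplex x vs.
Proof.
by rewrite /on_simplex inT_perm; congr (_ && _); apply: eq_forallb => b; rewrite tangent_perm.
Qed.

Lemma restr_on k (f : form R 3 k) x vs : on_simplex x vs -> restr R 3 k f x vs = f x vs.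
Proof. by rewrite /restr -/(on_simplex x vs) => ->. Qed.

Lemma restr_out k (f : form R 3 k) x vs : ~~ on_simplex x vs -> restr R 3 k f x vs = 0.
Proof. by rewrite /restr -/(on_simplex x vs) => /negbTE ->. Qed.

Lemma Phi1_lin a p q x vs : Phi1 (a *: p + q) x vs = a * Phi1 p x vs + Phi1 q x vs.
Proof.
have [d|d] := boolP (on_simplex x vs); last by rewrite /Phi1 !restr_out // mulr0 addr0.
rewrite /Phi1 !restr_on // mulr_sumr -big_split; apply: eq_bigr => i _.
by rewrite !ffunE mevalD mevalZ /=; ring.
Qed.

Lemma Phi2_lin a p q x vs : Phi2 (a *: p + q) x vs = a * Phi2 p x vs + Phi2 q x vs.
Proof.
have [d|d] := boolP (on_simplex x vs); last by rewrite /Phi2 !restr_out // mulr0 addr0.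
rewrite /Phi2 !restr_on // !det4E /= !ffunE !mevalD !mevalZ; ring.
Qed.

Lemma Phi1_act (s : 'S_4) p x vs :
  Defs.act R 3 s 1 (Phi1 p) x vs = (-1) ^+ false * Phi1 (vact s p) x vs.
Proof.
rewrite mul1r /Defs.act /Phi1.
have [d|d] := boolP (on_simplex x vs); last by rewrite !restr_out ?on_simplex_perm.
rewrite !restr_on ?on_simplex_perm // [RHS](reindex_inj (@perm_inj _ s)).
by apply: eq_bigr => i _; rewrite ffunE permK meval_msym.
Qed.

Lemma Phi2_act (s : 'S_4) p x vs :
  Defs.act R 3 s 2 (Phi2 p) x vs = (-1) ^+ (s : bool) * Phi2 (vact s p) x vs.
Proof.
rewrite /Defs.act /Phi2.
have [d|d] := boolP (on_simplex x vs); last by rewrite !restr_out ?on_simplex_perm // mulr0.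
rewrite !restr_on ?on_simplex_perm // -det4_perm /det4; congr (\det _).
apply/matrixP => i j; rewrite !mxE; elim/ord4_ind: i => //=.
by rewrite ffunE permK meval_msym.
Qed.

Lemma sum_e i : \sum_j e_ i j = 1.
Proof.
rewrite (bigD1 i) //= big1 ?addr0 /unit_pt ?eqxx // => j.
by rewrite eq_sym => /negbTE ->.
Qed.

Definition edge (i k : 'I_4) : pt := fun j => e_ i j - e_ k j.

Lemma edge_tangent i k : tangent (edge i k).
Proof. by rewrite /Defs.tangent sumrB !sum_e subrr. Qed.

Lemma edge_pairing i k (f : 'I_4 -> R) : \sum_j edge i k j * f j = f i - f k.
Proof.
have h l : \sum_j e_ l j * f j = f l.
  rewrite (bigD1 l) //= big1 ?addr0 /unit_pt ?eqxx ?mul1r // => j.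
  by rewrite eq_sym => /negbTE ->; rewrite mul0r.
by under eq_bigr do rewrite mulrBl; rewrite sumrB !h.
Qed.

Lemma homog_predB d (f g : mp) : homog_pred d f -> homog_pred d g -> homog_pred d (f - g).
Proof. by move=> hf hg; rewrite addrC -scaleN1r; apply: homog_pred_lin. Qed.

Lemma Phi1_edge p x i k : inT x ->
  Phi1 p x (fun=> edge i k) = (p i).@[x] - (p k).@[x].
Proof.
move=> xT; rewrite /Phi1 restr_on ?edge_pairing //.
by apply/andP; split=> //; apply/forallP => b; apply: edge_tangent.
Qed.

(** Evaluation on edge vectors detects differences of coefficients. Nothing more can be concluded,
    as the [d lambda_i] sum to zero on tangent vectors. *)
Lemma Phi1_ker d p : (forall i, homog_pred d (p i)) -> (forall x vs, Phi1 p x vs = 0) ->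
  forall i k, p i = p k.
Proof.
move=> hp p0 i k; apply/eqP; rewrite -subr_eq0; apply/eqP.
apply: (@homog_pred_eq0 _ d) => [|x xT]; first exact: homog_predB.
by rewrite mevalB -Phi1_edge.
Qed.

Definition spoke (a : 'I_4) x : pt := fun j => e_ a j - x j.

Lemma spoke_tangent a x : inT x -> tangent (spoke a x).
Proof. by case/andP=> _ /eqP x1; rewrite /Defs.tangent sumrB sum_e x1 subrr. Qed.

(** The spoke from [x] to a vertex is tangent, and its component [- x] disappears from a determinant
    that already has the row [x]. Taking [a], [b] complementary to [i], [k] leaves a 2 by 2 minor;
    since they avoid [i], both spokes stay in the face [x_i = 0] when [x] lies there. *)
Lemma minor_spokes i k : i != k -> exists a b, exists e : bool,
  [/\ a != i, b != i & forall x (u : pt),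
  det4 x u (spoke a x) (spoke b x) = (-1) ^+ e * (x i * u k - x k * u i)].
Proof.
have m a b x (u : pt) : det4 x u (spoke a x) (spoke b x) = det4 x u (e_ a) (e_ b).
  by rewrite !det4E /spoke /=; ring.
have pick a b (e : bool) : a != i -> b != i ->
    (forall x (u : pt), det4 x u (e_ a) (e_ b) = (-1) ^+ e * (x i * u k - x k * u i)) ->
    exists a b, exists e : bool, [/\ a != i, b != i & forall x (u : pt),
     det4 x u (spoke a x) (spoke b x) = (-1) ^+ e * (x i * u k - x k * u i)].
  by move=> ai bi h; exists a, b, e; split=> // x u; rewrite m.
move: pick; elim/ord4_ind: i; elim/ord4_ind: k => // pick _.
- by apply: (pick o2 o3 false) => // x u; rewrite det4E /unit_pt /=; ring.
- by apply: (pick o1 o3 true) => // x u; rewrite det4E /unit_pt /=; ring.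
- by apply: (pick o1 o2 false) => // x u; rewrite det4E /unit_pt /=; ring.
- by apply: (pick o2 o3 true) => // x u; rewrite det4E /unit_pt /=; ring.
- by apply: (pick o0 o3 false) => // x u; rewrite det4E /unit_pt /=; ring.
- by apply: (pick o0 o2 true) => // x u; rewrite det4E /unit_pt /=; ring.
- by apply: (pick o1 o3 false) => // x u; rewrite det4E /unit_pt /=; ring.
- by apply: (pick o0 o3 true) => // x u; rewrite det4E /unit_pt /=; ring.
- by apply: (pick o0 o1 false) => // x u; rewrite det4E /unit_pt /=; ring.
- by apply: (pick o1 o2 true) => // x u; rewrite det4E /unit_pt /=; ring.
- by apply: (pick o0 o2 false) => // x u; rewrite det4E /unit_pt /=; ring.
- by apply: (pick o0 o1 true) => // x u; rewrite det4E /unit_pt /=; ring.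
Qed.

Definition pair_of (v w : pt) : 'I_2 -> pt := fun b => if b == ord0 then v else w.

Lemma on_simplex_pair x v w : inT x -> tangent v -> tangent w -> on_simplex x (pair_of v w).
Proof.
by move=> xT vt wt; apply/andP; split=> //; apply/forallP => b; rewrite /pair_of; case: ifP.
Qed.

Lemma Phi2_pair u x v w : inT x -> tangent v -> tangent w ->
  Phi2 u x (pair_of v w) = det4 x (fun i => (u i).@[x]) v w.
Proof. by move=> xT vt wt; rewrite /Phi2 restr_on //; apply: on_simplex_pair. Qed.

Lemma homog_predXl d (f : mp) i : homog_pred d f -> homog_pred d.+1 ('X_i * f).
Proof.
move=> hf; rewrite mulrC -addn1; apply: homog_predM => //.
by rewrite dhomogX; apply/eqP; exact: mdeg1.
Qed.

Lemma Phi2_ker d u : (forall i, homog_pred d (u i)) -> (forall x vs, Phi2 u x vs = 0) ->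
  forall i k, 'X_i * u k = 'X_k * u i.
Proof.
move=> hu u0 i k; have [->//|ik] := eqVneq i k.
apply/eqP; rewrite -subr_eq0; apply/eqP.
apply: (@homog_pred_eq0 _ d.+1) => [|x xT]; first by apply: homog_predB; apply: homog_predXl.
have [a [b [e [_ _ h]]]] := minor_spokes ik.
have := h x (fun i => (u i).@[x]); rewrite -Phi2_pair ?spoke_tangent // u0.
rewrite mevalB !mevalM !mevalXU => /esym/eqP.
by rewrite mulf_eq0 signr_eq0 => /eqP.
Qed.

(** On the face [x_j = 0] the minor of [j] and [c] reduces to [- x_c u_j]; since the [x_c] sum to 1,
    vanishing of all these minors forces [u_j = 0] on that face. *)
Lemma trace_free_Phi2 d u : (forall i, homog_pred d (u i)) -> trace_free 2 (Phi2 u) ->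
  forall j (m : mon), m j = 0%N -> (u j)@_m = 0.
Proof.
move=> hu tf j m mj.
apply: (@homog_pred_vanish _ d _ (pred1 j) (if j == o0 then o1 else o0)) => //.
- by elim/ord4_ind: (j).
- move=> x xT /(_ j (eqxx j)) xj.
  have x1 : \sum_c x c = 1 by case/andP: xT => _ /eqP.
  rewrite -[LHS]mul1r -x1 mulr_suml big1 // => c _.
  have [->|cj] := eqVneq c j; first by rewrite xj mul0r.
  have [|a [b [e [aj bj h]]]] := @minor_spokes j c; first by rewrite eq_sym.
  have := h x (fun i => (u i).@[x]); rewrite -Phi2_pair ?spoke_tangent // (tf j) //.
    by rewrite xj mul0r sub0r => /esym/eqP; rewrite mulf_eq0 signr_eq0 oppr_eq0 => /eqP.
  by move=> t; rewrite /pair_of; case: ifP => _; split; rewrite ?spoke_tangent //;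
     rewrite /spoke /unit_pt xj subr0 ?(negbTE aj) ?(negbTE bj).
- by move=> l /eqP ->.
Qed.

Lemma meval_face (f : mp) j x : (forall m : mon, m j = 0%N -> f@_m = 0) -> x j = 0 -> f.@[x] = 0.
Proof.
move=> h xj; rewrite mevalE big1 // => m _.
have [mj|mj] := eqVneq (m j) 0%N; first by rewrite h // mul0r.
by rewrite (bigD1 j) //= xj expr0n (negbTE mj) mul0r mulr0.
Qed.

Lemma Phi2_trace_free u : (forall j (m : mon), m j = 0%N -> (u j)@_m = 0) ->
  trace_free 2 (Phi2 u).
Proof.
move=> h j x vs xT xj hv.
have [d|d] := boolP (on_simplex x vs); last by rewrite /Phi2 restr_out.
have [v0 w0] := (proj2 (hv ord0), proj2 (hv ord_max)).
have uj := meval_face (h j) xj.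
rewrite /Phi2 restr_on // det4E /=.
by elim/ord4_ind: j xj v0 w0 uj {h hv} => -> -> -> ->; ring.
Qed.

Lemma trace_free_Phi1 d p : (forall i, homog_pred d (p i)) -> trace_free 1 (Phi1 p) ->
  forall j i k x, i != j -> k != j -> inT x -> x j = 0 -> (p i).@[x] = (p k).@[x].
Proof.
move=> hp tf j i k x ij kj xT xj; apply/eqP; rewrite -subr_eq0 -Phi1_edge // (tf j) //.
move=> b; split; first exact: edge_tangent.
by rewrite /edge /unit_pt (negbTE ij) (negbTE kj) subrr.
Qed.

Lemma Phi1_trace_free p : (forall i j (m : mon), i != j -> m j = 0%N -> (p i)@_m = 0) ->
  trace_free 1 (Phi1 p).
Proof.
move=> h j x vs xT xj hv.
have [d|d] := boolP (on_simplex x vs); last by rewrite /Phi1 restr_out.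
rewrite /Phi1 restr_on // big1 // => i _; have [->|ij] := eqVneq i j.
  by rewrite (proj2 (hv ord0)) mul0r.
by rewrite (@meval_face _ j) ?mulr0 // => m; apply: h.
Qed.

Lemma trace_free_ext k (w w' : form R 3 k) : (forall x vs, w x vs = w' x vs) ->
  trace_free k w -> trace_free k w'.
Proof. by move=> e tf j x vs xT xj hv; rewrite -e (tf j). Qed.

End Identification.

(** * The eight spaces as block spaces *)

Section Spaces.
Variable R : realType.
Local Notation mp := {mpoly R[4]}.
Local Notation vec := (vec R).
Local Notation blk := (blk R).
Local Notation pt := (pt R 3).
Local Notation trace_free := (trace_free R 3).
Implicit Types (p u : vec) (x : pt).

Lemma blockE sg p m i :
  block sg p m i = if (sg i <= m)%MM then (p i)@_(m - sg i)%MM else 0.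
Proof. by rewrite ffunE mcoeff_XM. Qed.

Lemma block_add sg p m i : block sg p (m + sg i)%MM i = (p i)@_m.
Proof. by rewrite ffunE mulrC addmC mcoeffMX. Qed.

(** The successor compensates for [homog_pred d] meaning degree [d - 1]: shifted entries have degree
    [D = d - 1 + e]. *)
Lemma blockspaceP sg d e D W p : (forall i, mdeg (sg i) = e) -> D.+1 = (d + e)%N ->
  block_closed W ->
  blockspace sg (of_deg D) W p <->
  (forall i, homog_pred d (p i)) /\ forall m, W m (block sg p m).
Proof.
move=> sge De [W0 _ _]; split=> [h|[hp hW] m]; last first.
  case: ifP => [_|/negbT mD]; first exact: hW.
  apply/ffunP => i; rewrite blockE [RHS]ffunE; case: ifP => // le.
  apply/eqP; apply/negPn/negP => /hp dd; case/negP: mD.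
  by rewrite /of_deg /= -eqSS De -dd -{1}(submK le) mdegD sge addSn.
split=> [i m pm|m]; last first.
  by have := h m; case: ifP => // _ ->; apply: W0.
have := h (m + sg i)%MM; case: ifP => [/eqP mD _|_ /ffunP/(_ i)].
  by apply/eqP; rewrite -(eqn_add2r e) -De -mD mdegD sge addSn.
by rewrite block_add ffunE => p0; rewrite p0 eqxx in pm.
Qed.

Lemma mdeg_shift0 i : mdeg (shift0 i) = 0%N. Proof. exact: mdeg0. Qed.
Lemma mdeg_shift1 i : mdeg (shift1 i) = 1%N. Proof. exact: mdeg1. Qed.
Lemma mdeg_shift3 i : mdeg (shift3 i) = 3%N.
Proof. by rewrite mdegE big4 /= !mnmE; elim/ord4_ind: i. Qed.

Lemma block0E p m i : block (@shift0) p m i = (p i)@_m.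
Proof. by rewrite ffunE mpolyX0 mul1r. Qed.

Lemma sum_block0 p m : \sum_i block (@shift0) p m i = (\sum_i p i)@_m.
Proof. by rewrite raddf_sum; apply: eq_bigr => i _; rewrite block0E. Qed.

Lemma sum_block1 p m : \sum_i block (@shift1) p m i = (\sum_i 'X_i * p i)@_m.
Proof. by rewrite raddf_sum; apply: eq_bigr => i _; rewrite ffunE. Qed.

(** Used for injectivity: the relevant kernel elements have constant blocks. Such a block is killed
    by the sum condition on full supports, and by any single forced zero otherwise. *)
Lemma equal_blocks_cofull (m : mon) (c : blk) : (forall i k, c i = c k) ->
  W_cofull m c -> c = 0.
Proof.
move=> ceq [cs c0]; have [m0|/nzeros_neq0[j mj]] := boolP (nzeros m == 0%N).
  have := cs (elimT (nzeros_eq0P _) m0).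
  rewrite big4 /= (ceq o1 o0) (ceq o2 o0) (ceq o3 o0) => e.
  have {}e : c o0 = 0 by lra.
  by apply/ffunP => i; rewrite ffunE (ceq i o0).
apply/ffunP => i; rewrite ffunE (ceq i (if j == o0 then o1 else o0)) (c0 _ j) //.
by elim/ord4_ind: (j).
Qed.

Lemma equal_blocks_sum (m : mon) (c : blk) : (forall i k, c i = c k) ->
  \sum_i c i = 0 -> c = 0.
Proof.
move=> ceq; rewrite big4 /= (ceq o1 o0) (ceq o2 o0) (ceq o3 o0) => e.
have {}e : c o0 = 0 by lra.
by apply/ffunP => i; rewrite ffunE (ceq i o0).
Qed.

Definition allX : mon := [multinom 1%N | _ < 4].

Lemma shift3_X i : (shift3 i + U_(i))%MM = allX.
Proof. by apply/mnmP => j; rewrite mnmDE !mnmE; case: eqP. Qed.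

Lemma Phi2_ker_blocks3 u : (forall i k, 'X_i * u k = 'X_k * u i) ->
  forall m i k, block (@shift3) u m i = block (@shift3) u m k.
Proof.
move=> h m i k; rewrite !ffunE; congr (_ @_ m).
have X0 j : ('X_j : mp) != 0.
  apply/eqP => /(congr1 (fun q : mp => q@_U_(j)%MM)); rewrite mcoeff0 mcoeffXU eqxx.
  by move/eqP; rewrite oner_eq0.
apply: (mulfI (X0 i)); apply: (mulfI (X0 k)).
have e j : 'X_j * 'X_[shift3 j] = 'X_[allX] :> mp.
  by rewrite -mpolyXD addmC shift3_X.
transitivity ('X_[allX] * ('X_k * u i)); first by rewrite -(e i); ring.
by rewrite -h -(e k); ring.
Qed.

Lemma sumX_inj (q : mp) : sumX R * q = 0 -> q = 0.
Proof. by move/eqP; rewrite mulf_eq0 (negbTE (sumX_neq0 R)) => /eqP. Qed.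

Lemma mpoly_of (d : nat) (E : mon -> R) : (forall m, E m != 0 -> (mdeg m < d)%N) ->
  exists c : mp, forall m, c@_m = E m.
Proof.
move=> hE; exists (\sum_(m : 'X_{1..4 < d}) E m *: 'X_[m]) => m.
case: (ltnP (mdeg m) d) => lt; first exact: mcoeff_mpoly.
have /eqP -> : E m == 0 by apply: contraLR lt => /hE; rewrite -ltnNge.
rewrite raddf_sum big1 // => n _ /=; rewrite mcoeffZ mcoeffX.
case: eqP => [e|_]; last by rewrite mulr0.
by have := bmdeg n; rewrite e ltnNge lt.
Qed.

(* Adding a multiple of the position vector field does not change
   [det4 x (u x) v w]. *)
Lemma radial_normalization r u : (forall i, homog_pred r (u i)) -> exists u' : vec,
  [/\ forall i, homog_pred r (u' i), forall x vs, Phi2 u' x vs = Phi2 u x vs,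
      forall m : mon, (forall j, m j <> 0%N) -> \sum_i block (@shift3) u' m i = 0
    & forall (m : mon) j, m j = 0%N -> block (@shift3) u' m = block (@shift3) u m].
Proof.
(* The mean of the four block entries at [n + allX]; subtracting it makes the block there sum to
   zero and touches only monomials of full support. *)
move=> hu; pose E (n : mon) : R := (\sum_i (u i)@_(n + U_(i))) / 4%:R.
have hE n : E n != 0 -> (mdeg n).+2 = r.
  case: (pickP (fun i => (u i)@_(n + U_(i)) != 0)) => [i /hu <- _|z].
    by rewrite mdegD mdeg1 addn1.
  by rewrite /E big1 ?mul0r ?eqxx // => i _; have := z i; case: eqP.
have [a ha] : exists a : mp, forall n, a@_n = E n.
  by apply: (@mpoly_of r) => n /hE <-; rewrite ltnS leqnSn.
pose u' : vec := [ffun i => u i - 'X_i * a].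
have b' m i : block (@shift3) u' m i = block (@shift3) u m i - ('X_[allX] * a)@_m.
  rewrite !ffunE mulrBr mcoeffB; congr (_ - _@_m).
  by rewrite mulrA -mpolyXD shift3_X.
exists u'; split.
- move=> i; rewrite ffunE; apply: homog_predB => // m; rewrite mcoeff_XM.
  case: ifP => [le|_]; last by rewrite eqxx.
  by rewrite ha => /hE <-; rewrite -{1}(submK le) mdegD mdeg1 addn1.
- move=> x vs; have [d|d] := boolP (on_simplex x vs); last by rewrite /Phi2 !restr_out.
  rewrite /Phi2 !restr_on // !det4E /= !ffunE !mevalB !mevalM !mevalXU; ring.
- move=> m m0; under eq_bigr do rewrite b'.
  have le1 : (allX <= m)%MM by apply/mnm_lepP => j; rewrite mnmE lt0n; apply/eqP.
  rewrite sumrB mcoeff_XM le1 ha /E !big4 /= !blockE.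
  have le3 i : (shift3 i <= m)%MM.
    by apply/mnm_lepP => j; have := m0 j; rewrite mnmE; case: (i != j) => //; lia.
  have e i : (m - shift3 i = m - allX + U_(i))%MM.
    apply/mnmP => j; rewrite mnmDE !mnmBE !mnmE; have := m0 j; case: eqP => //=; lia.
  by rewrite !le3 !e; field.
- move=> m j mj; apply/ffunP => i; rewrite b' mcoeff_XM ifF ?subr0 //.
  by apply/negbTE/mnm_lepP => /(_ j); rewrite mnmE mj.
Qed.

(** * Identification of each space and injectivity *)

Section Images.
Variable r : nat.

(* The letter [o] marks the trace-free spaces. *)
Let S_PT := blockspace (@shift0) (of_deg r) (@W_sum R).
Let S_PM1 := blockspace (@shift1) (of_deg r.+1) (@W_supp R).
Let S_PM2 := blockspace (@shift3) (of_deg r.+2) (@W_cofull R).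
Let S_oPT1 := blockspace (@shift0) (of_deg r) (@W_cofull R).
Let S_oPM1 := blockspace (@shift1) (of_deg r.+1) (@W_full R).
Let S_oPT2 := blockspace (@shift0) (of_deg r) (@W_supp R).
Let S_oPM2 := blockspace (@shift3) (of_deg r.+2) (@W_full R).

Lemma S_PTP p : S_PT p <-> (forall i, homog_pred r.+1 (p i)) /\ \sum_i p i = 0.
Proof.
rewrite /S_PT (blockspaceP _ (d := r.+1) mdeg_shift0) ?addn0 //; last exact: W_sum_closed.
split=> -[hp h]; split=> //.
  by apply/mpolyP => m; rewrite mcoeff0 -sum_block0; apply: h.
by move=> m; rewrite /W_sum sum_block0 h mcoeff0.
Qed.

Lemma S_PM1P p : S_PM1 p <-> (forall i, homog_pred r.+1 (p i)) /\ \sum_i 'X_i * p i = 0.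
Proof.
rewrite /S_PM1 (blockspaceP _ (d := r.+1) mdeg_shift1) ?addn1 //; last exact: W_supp_closed.
split=> -[hp h]; split=> //.
  by apply/mpolyP => m; rewrite mcoeff0 -sum_block1; case: (h m).
move=> m; split; first by rewrite sum_block1 h mcoeff0.
by move=> i mi; rewrite blockE shift1_le mi.
Qed.

Lemma S_PM2P p : S_PM2 p <-> (forall i, homog_pred r (p i)) /\
  forall m : mon, (forall j, m j <> 0%N) -> \sum_i block (@shift3) p m i = 0.
Proof.
rewrite /S_PM2 (blockspaceP _ (d := r) mdeg_shift3) ?addn3 //; last exact: W_cofull_closed.
split=> -[hp h]; split=> //; first by move=> m; case: (h m).
move=> m; split=> [|i j ij mj]; first exact: h.
rewrite blockE ifF //; apply/negbTE; rewrite shift3_le negb_forall.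
by apply/existsP; exists j; rewrite ij mj.
Qed.

Lemma S_oPT1P p : S_oPT1 p <-> (forall i, homog_pred r.+1 (p i)) /\ forall m, W_cofull m (block (@shift0) p m).
Proof. by apply: (blockspaceP _ mdeg_shift0); [rewrite addn0|exact: W_cofull_closed]. Qed.

Lemma S_oPM1P p : S_oPM1 p <-> [/\ forall i, homog_pred r.+1 (p i), \sum_i 'X_i * p i = 0 &
  forall i j (m : mon), i != j -> m j = 0%N -> (p i)@_m = 0].
Proof.
rewrite /S_oPM1 (blockspaceP _ (d := r.+1) mdeg_shift1) ?addn1 //; last exact: W_full_closed.
split=> [[hp h]|[hp hs h]]; split=> //.
- by apply/mpolyP => m; rewrite mcoeff0 -sum_block1; case: (h m).
- move=> i j m ij mj; rewrite -(block_add (@shift1)); case: (h (m + shift1 i)%MM) => _ /(_ i j); apply.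
  by rewrite mnmDE mj mnm1E (negbTE ij).
- move=> m; split=> [|i j mj]; first by rewrite sum_block1 hs mcoeff0.
  rewrite blockE; case: ifP => // le; have [e|ij] := eqVneq i j.
    by rewrite shift1_le e mj in le.
  by apply: (h i j) => //; rewrite mnmBE mj.
Qed.

Lemma S_oPT2P p : S_oPT2 p <-> [/\ forall i, homog_pred r.+1 (p i), \sum_i p i = 0 &
  forall j (m : mon), m j = 0%N -> (p j)@_m = 0].
Proof.
rewrite /S_oPT2 (blockspaceP _ (d := r.+1) mdeg_shift0) ?addn0 //; last exact: W_supp_closed.
split=> [[hp h]|[hp hs h]]; split=> //.
- by apply/mpolyP => m; rewrite mcoeff0 -sum_block0; case: (h m).
- by move=> j m mj; rewrite -block0E; case: (h m) => _; apply.
- by move=> m; split=> [|i mi]; rewrite ?sum_block0 ?hs ?mcoeff0 // block0E h.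
Qed.

Lemma S_oPM2P p : S_oPM2 p <-> [/\ forall i, homog_pred r (p i),
  forall m : mon, (forall j, m j <> 0%N) -> \sum_i block (@shift3) p m i = 0 &
  forall j (m : mon), m j = 0%N -> (p j)@_m = 0].
Proof.
rewrite /S_oPM2 (blockspaceP _ (d := r) mdeg_shift3) ?addn3 //; last exact: W_full_closed.
split=> [[hp h]|[hp hs h]]; split=> //.
- by move=> m _; case: (h m).
- move=> j m mj; rewrite -(block_add (@shift3)); case: (h (m + shift3 j)%MM) => _ /(_ j j); apply.
  by rewrite mnmDE mj mnmE eqxx.
- have z (m : mon) i j : m j = 0%N -> block (@shift3) p m i = 0.
    move=> mj; rewrite blockE; case: ifP => // le; have [e|ij] := eqVneq i j.
      by apply: h; rewrite mnmBE e mj.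
    by move/mnm_lepP: le => /(_ j); rewrite mnmE ij mj.
  move=> m; split=> [|i j]; last exact: z.
  have [m0|/nzeros_neq0[j mj]] := boolP (nzeros m == 0%N); first by apply/hs/nzeros_eq0P.
  by rewrite big1 // => i _; apply: (z _ _ j).
Qed.

Lemma PT1_image w : PT r 1 w <-> exists p, S_PT p /\ forall x vs, w x vs = Phi1 p x vs.
Proof.
rewrite PT1_coords; split=> [[p [hp ew]]|[p [/S_PTP[hp _] ew]]]; last by exists p.
(* Subtracting the mean leaves the form unchanged, because the [d lambda_i] sum to zero on tangent
   vectors. *)
exists [ffun i => p i - 4%:R^-1 *: \sum_k p k]; split=> [|x vs].
  apply/S_PTP; split=> [i|].
    rewrite ffunE; apply: homog_predB => //; rewrite -[_ *: _]addr0.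
    by apply: homog_pred_lin (homog_pred_zero _); apply: homog_pred_sum.
  under eq_bigr do rewrite ffunE.
  rewrite sumrB sumr_const card_ord -scaler_nat scalerA mulfV ?scale1r ?subrr //.
  by rewrite pnatr_eq0.
rewrite ew; apply: restr_eq => y us /on_simplexE[_ us0].
under [RHS]eq_bigr do rewrite ffunE mevalB mulrBr.
by rewrite sumrB -mulr_suml us0 mul0r subr0.
Qed.

Lemma PT2_image w : PT r 2 w <-> exists p, S_PT p /\ forall x vs, w x vs = Phi2 p x vs.
Proof.
rewrite PT2_coords; split=> [[p [hp h ew]]|[p [/S_PTP[hp h] ew]]]; exists p; split=> //.
by apply/S_PTP.
Qed.

Lemma PM1_image w : PminusT r 1 w <-> exists p, S_PM1 p /\ forall x vs, w x vs = Phi1 p x vs.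
Proof.
rewrite Pminus1_coords; split=> [[p [hp h ew]]|[p [/S_PM1P[hp h] ew]]]; exists p; split=> //.
by apply/S_PM1P.
Qed.

Lemma PM2_image w : PminusT r 2 w <-> exists p, S_PM2 p /\ forall x vs, w x vs = Phi2 p x vs.
Proof.
rewrite Pminus2_coords; split=> [[u [hu ew]]|[p [/S_PM2P[hp h] ew]]]; last by exists p.
have [u' [hu' e hs _]] := radial_normalization hu.
by exists u'; split=> [|x vs]; [apply/S_PM2P|rewrite e].
Qed.

Lemma oPM1_image w : ringed (PminusT r 1) w <->
  exists p, S_oPM1 p /\ forall x vs, w x vs = Phi1 p x vs.
Proof.
split=> [[/Pminus1_coords[p [hp hs ew]] tf]|[p [/S_oPM1P[hp hs h] ew]]].
  exists p; split=> //; apply/S_oPM1P; split=> // i j m ij mj.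
  apply: (@homog_pred_vanish _ r.+1 _ (pred1 j) i) => //; last by move=> l /eqP ->.
  move=> x xT /(_ j (eqxx j)) xj.
  have heq := trace_free_Phi1 hp (trace_free_ext ew tf).
  (* On the face [x_j = 0] the coefficients other than the j-th agree, so the radial relation
     becomes the coordinate sum times their common value. *)
  have := congr1 (fun q : mp => q.@[x]) hs.
  rewrite (big_morph _ (mevalD x) (meval0 x)) meval0.
  rewrite (eq_bigr (fun k => x k * (p i).@[x])) => [|k _].
    by case/andP: xT => _ /eqP x1; rewrite -mulr_suml x1 mul1r.
  rewrite mevalM mevalXU; have [->|kj] := eqVneq k j; first by rewrite xj !mul0r.
  by rewrite (heq j k i).
split; first by apply/Pminus1_coords; exists p; split.
by apply: trace_free_ext (Phi1_trace_free h) => x vs; rewrite ew.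
Qed.

Lemma oPT2_image w : ringed (PT r 2) w <->
  exists p, S_oPT2 p /\ forall x vs, w x vs = Phi2 p x vs.
Proof.
split=> [[/PT2_coords[p [hp hs ew]] tf]|[p [/S_oPT2P[hp hs h] ew]]].
  exists p; split=> //; apply/S_oPT2P; split=> //.
  exact: trace_free_Phi2 hp (trace_free_ext ew tf).
split; first by apply/PT2_coords; exists p; split.
by apply: trace_free_ext (Phi2_trace_free h) => x vs; rewrite ew.
Qed.

Lemma oPM2_image w : ringed (PminusT r 2) w <->
  exists p, S_oPM2 p /\ forall x vs, w x vs = Phi2 p x vs.
Proof.
split=> [[/Pminus2_coords[p [hp ew]] tf]|[p [/S_oPM2P[hp hs h] ew]]].
  have [u' [hu' e hs hz]] := radial_normalization hp.
  have eu x vs : w x vs = Phi2 u' x vs by rewrite e.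
  exists u'; split=> //; apply/S_oPM2P; split=> //.
  exact: trace_free_Phi2 hu' (trace_free_ext eu tf).
split; first by apply/Pminus2_coords; exists p; split.
by apply: trace_free_ext (Phi2_trace_free h) => x vs; rewrite ew.
Qed.

(** Trace-freeness only makes the coefficients other than the j-th agree on the face [x_j = 0]. A
    common polynomial [c] is subtracted, chosen monomial by monomial, to make them vanish there. *)
Lemma oPT1_image w : ringed (PT r 1) w <->
  exists p, S_oPT1 p /\ forall x vs, w x vs = Phi1 p x vs.
Proof.
split=> [[/PT1_coords[p [hp ew]] tf]|[p [/S_oPT1P[hp hW] ew]]]; last first.
  split; first by apply/PT1_coords; exists p; split.
  apply: trace_free_ext (_ : trace_free 1 (Phi1 p)) => [x vs|]; first by rewrite ew.
  apply: Phi1_trace_free => i j m ij mj; rewrite -block0E.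
  by case: (hW m) => _; apply; [exact: ij|].
have heq i k j (m : mon) : i != j -> k != j -> m j = 0%N -> (p i)@_m = (p k)@_m.
  move=> ij kj mj; apply/eqP; rewrite -subr_eq0 -mcoeffB; apply/eqP.
  apply: (@homog_pred_vanish _ r.+1 _ (pred1 j) i) => //; first exact: homog_predB.
    move=> x xT /(_ j (eqxx j)) xj; rewrite mevalB.
    by rewrite (trace_free_Phi1 hp (trace_free_ext ew tf) ij kj) ?subrr.
  by move=> l /eqP ->.
pose other (j : 'I_4) : 'I_4 := if j == o0 then o1 else o0.
have otherP j : other j != j by elim/ord4_ind: j.
(* With a zero exponent at [j], the value shared by all entries except the j-th; on full support,
   the mean. *)
pose E (m : mon) : R := if [pick j | m j == 0%N] is Some j then (p (other j))@_m
  else (\sum_i (p i)@_m) / 4%:R.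
have hE m : E m != 0 -> (mdeg m).+1 = r.+1.
  rewrite /E; case: pickP => [j _ /hp //|_].
  case: (pickP (fun i => (p i)@_m != 0)) => [i /hp //|z].
  by rewrite big1 ?mul0r ?eqxx // => i _; have := z i; case: eqP.
have [c hc] : exists c : mp, forall n, c@_n = E n.
  by apply: (@mpoly_of r.+1) => n /hE <-.
exists [ffun i => p i - c]; split=> [|x vs]; last first.
  rewrite ew; apply: restr_eq => y us /on_simplexE[_ us0].
  under [RHS]eq_bigr do rewrite ffunE mevalB mulrBr.
  by rewrite sumrB -mulr_suml us0 mul0r subr0.
apply/S_oPT1P; split=> [i|m].
  by rewrite ffunE; apply: homog_predB => // m; rewrite hc; apply: hE.
have bE i : block (@shift0) [ffun i => p i - c] m i = (p i)@_m - E m.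
  by rewrite block0E ffunE mcoeffB hc.
split=> [m0|i j ij mj].
  under eq_bigr do rewrite bE.
  rewrite sumrB /E; case: pickP => [j /eqP /m0 //|_].
  by rewrite !big4 /=; field.
rewrite bE /E; case: pickP => [j' /eqP mj'|/(_ j)]; last by rewrite mj.
have [e|ij'] := eqVneq i j'; last by rewrite (heq i (other j') j') ?subrr.
(* The value does not depend on which zero exponent was picked: a third index [l] links the face
   [j], on which [i] is compared, with the picked face [j']. *)
have [l lj lj'] : exists2 l : 'I_4, l != j & l != j'.
  move: ij; rewrite e; elim/ord4_ind: (j); elim/ord4_ind: (j') => // _;
  by [exists o0|exists o1|exists o2|exists o3].
by rewrite (heq i l j) // (heq l (other j') j') ?subrr.
Qed.

Lemma S_PT_inj1 p : S_PT p -> (forall x vs, Phi1 p x vs = 0) -> p = 0.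
Proof.
move=> /S_PTP[hp hs] /(Phi1_ker hp) e; apply: (@block_inj _ (@shift0)) => m.
rewrite block0; apply: equal_blocks_sum => [//|i k|]; first by rewrite !block0E (e i k).
by rewrite sum_block0 hs mcoeff0.
Qed.

Lemma S_oPT1_inj p : S_oPT1 p -> (forall x vs, Phi1 p x vs = 0) -> p = 0.
Proof.
move=> /S_oPT1P[hp hW] /(Phi1_ker hp) e; apply: (@block_inj _ (@shift0)) => m.
by rewrite block0; apply: equal_blocks_cofull (hW m) => i k; rewrite !block0E (e i k).
Qed.

Lemma S_PM1_inj p : S_PM1 p -> (forall x vs, Phi1 p x vs = 0) -> p = 0.
Proof.
move=> /S_PM1P[hp hs] /(Phi1_ker hp) e; apply/ffunP => i; rewrite ffunE.
apply: sumX_inj; rewrite -hs /sumX mulr_suml; apply: eq_bigr => k _.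
by rewrite (e i k).
Qed.

Lemma S_oPM1_inj p : S_oPM1 p -> (forall x vs, Phi1 p x vs = 0) -> p = 0.
Proof. by move=> /S_oPM1P[hp hs _]; apply: S_PM1_inj; apply/S_PM1P. Qed.

Lemma S_PT_inj2 p : S_PT p -> (forall x vs, Phi2 p x vs = 0) -> p = 0.
Proof.
move=> /S_PTP[hp hs] /(Phi2_ker hp) e; apply/ffunP => i; rewrite ffunE.
apply: sumX_inj; rewrite /sumX mulr_suml; under eq_bigr do rewrite e.
by rewrite -mulr_sumr hs mulr0.
Qed.

Lemma S_oPT2_inj p : S_oPT2 p -> (forall x vs, Phi2 p x vs = 0) -> p = 0.
Proof. by move=> /S_oPT2P[hp hs _]; apply: S_PT_inj2; apply/S_PTP. Qed.

Lemma S_PM2_inj p : S_PM2 p -> (forall x vs, Phi2 p x vs = 0) -> p = 0.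
Proof.
move=> Sp /(Phi2_ker (proj1 (proj1 (S_PM2P p) Sp))) e.
apply: (@block_inj _ (@shift3)) => m; rewrite block0.
apply: equal_blocks_cofull (_ : W_cofull m _); first by move=> i k; apply: Phi2_ker_blocks3.
by move: Sp; rewrite /S_PM2 (blockspaceP _ (d := r) mdeg_shift3) ?addn3 => [[]||] //; exact: W_cofull_closed.
Qed.

Lemma S_oPM2_inj p : S_oPM2 p -> (forall x vs, Phi2 p x vs = 0) -> p = 0.
Proof. by move=> /S_oPM2P[hp hs _]; apply: S_PM2_inj; apply/S_PM2P. Qed.

End Images.

Lemma transport1 sg D W (V : form R 3 1 -> Prop) :
  shift_equivariant sg -> block_closed W ->
  (forall w, V w <-> exists p, blockspace sg (of_deg D) W p /\
     forall x vs, w x vs = Phi1 p x vs) ->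
  (forall p, blockspace sg (of_deg D) W p -> (forall x vs, Phi1 p x vs = 0) -> p = 0) ->
  has_inv_basis V <-> signed_basis (blockspace sg (of_deg D) W).
Proof.
move=> eqv Wcl im inj.
apply: (@has_inv_basis_transport R 1 V _ (@Phi1 R) (fun=> false)) => //.
- exact: Phi1_lin.
- exact: Phi1_act.
- exact: blockspace_lin.
- by apply: blockspace_vact => //; apply: of_deg_perm.
- by move=> m; rewrite block0; case: ifP => // _; case: Wcl.
Qed.

Lemma transport2 sg D W (V : form R 3 2 -> Prop) :
  shift_equivariant sg -> block_closed W ->
  (forall w, V w <-> exists p, blockspace sg (of_deg D) W p /\
     forall x vs, w x vs = Phi2 p x vs) ->
  (forall p, blockspace sg (of_deg D) W p -> (forall x vs, Phi2 p x vs = 0) -> p = 0) ->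
  has_inv_basis V <-> signed_basis (blockspace sg (of_deg D) W).
Proof.
move=> eqv Wcl im inj.
apply: (@has_inv_basis_transport R 2 V _ (@Phi2 R) (fun s => s : bool)) => //.
- exact: Phi2_lin.
- exact: Phi2_act.
- exact: blockspace_lin.
- by apply: blockspace_vact => //; apply: of_deg_perm.
- by move=> m; rewrite block0; case: ifP => // _; case: Wcl.
Qed.

Lemma shift0_le (m : mon) i : (shift0 i <= m)%MM.
Proof. by apply/mnm_lepP => j; rewrite mnm0E. Qed.

End Spaces.

Theorem theorem4p2 (R : realType) (r : nat) :
  has_inv_basis (PT (R:=R) (n:=3) r 1) /\
  (has_inv_basis (PminusT (R:=R) (n:=3) r 1) <-> ~ (exists m, r = 3 * m + 2)%N) /\
  has_inv_basis (PT (R:=R) (n:=3) r 2) /\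
  has_inv_basis (PminusT (R:=R) (n:=3) r 2) /\
  has_inv_basis (ringed (PT (R:=R) (n:=3) r 1)) /\
  has_inv_basis (ringed (PminusT (R:=R) (n:=3) r 1)) /\
  (has_inv_basis (ringed (PT (R:=R) (n:=3) r 2)) <-> ~ (exists m, r = 3 * m + 3)%N) /\
  has_inv_basis (ringed (PminusT (R:=R) (n:=3) r 2)).
Proof.
have [s0 s1 s3] := And3 (@shift0_eqv) (@shift1_eqv) (@shift3_eqv).
have [cs cu cf cc] := And4 (@W_sum_closed R) (@W_supp_closed R) (@W_full_closed R) (@W_cofull_closed R).
do ![split].
- apply/(transport1 s0 cs (@PT1_image R r) (@S_PT_inj1 R r)); exact: signed_basis_sum.
- move=> /(transport1 s1 cu (@PM1_image R r) (@S_PM1_inj R r)).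
  move=> /signed_basis_supp h [m e]; apply: h => //; first by move=> n i ni; rewrite shift1_le.
  by exists m; rewrite e; lia.
- move=> h; apply/(transport1 s1 cu (@PM1_image R r) (@S_PM1_inj R r))/signed_basis_supp => //.
    by move=> n i ni; rewrite shift1_le.
  by move=> [m e]; apply: h; exists m; lia.
- apply/(transport2 s0 cs (@PT2_image R r) (@S_PT_inj2 R r)); exact: signed_basis_sum.
- apply/(transport2 s3 cc (@PM2_image R r) (@S_PM2_inj R r))/signed_basis_cofull => // m i h.
  by rewrite shift3_le; apply/forallP => j; apply/implyP => /h/eqP.
- apply/(transport1 s0 cc (@oPT1_image R r) (@S_oPT1_inj R r))/signed_basis_cofull => // m i _.
  exact: shift0_le.
- apply/(transport1 s1 cf (@oPM1_image R r) (@S_oPM1_inj R r))/signed_basis_full => // m i h.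
  by rewrite shift1_le; apply/eqP.
- move=> /(transport2 s0 cu (@oPT2_image R r) (@S_oPT2_inj R r)).
  by move=> /signed_basis_supp h; apply: h => // m i _; exact: shift0_le.
- move=> h; apply/(transport2 s0 cu (@oPT2_image R r) (@S_oPT2_inj R r))/signed_basis_supp => // m i _.
  exact: shift0_le.
- apply/(transport2 s3 cf (@oPM2_image R r) (@S_oPM2_inj R r))/signed_basis_full => // m i h.
  by rewrite shift3_le; apply/forallP => j; apply/implyP => _; apply/eqP.
Qed.
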